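(* Let $X$ be a conservative Borel right process with state space $E$, let $S$ be a pricing kernel (a strictly positive semimartingale multiplicative functional of $X$ as specified in the context), and let $\mathscr{P}_t f(x)=\mathbb{E}^{\mathbb P}_x[S_t f(X_t)]$, $t\ge 0$, acting on Borel functions. Then there exists at most one, up to a multiplicative constant, strictly positive finite Borel function $\pi_R$ on $E$ such that (a) $\pi_R$ is an eigenfunction of every $\mathscr{P}_t$: for some real $\lambda$, $\mathscr{P}_t\pi_R(x)=e^{-\lambda t}\pi_R(x)$ for all $t>0$ and $x\in E$; and (b) $X$ is recurrent under the eigen-measure $\mathbb{Q}^{\pi_R}$ associated with $\pi_R$.
   Context: $E$ is a Lusin space (homeomorphic to a Borel subset of a compact metric space) having at least two points, with Borel sigma-field $\mathscr{E}$; $\mathscr{E}^*$ is the sigma-field of universally measurable subsets of $E$. $X=(\Omega,\mathscr{F},(\mathscr{F}_t)_{t\ge0},(X_t)_{t\ge0},(\mathbb{P}_x)_{x\in E})$ is a conservative Borel right process: a time-homogeneous strong Markov process with values in $E$, with right-continuous paths, shift operators $\theta_t:\Omega\to\Omega$ ($X_s\circ\theta_t=X_{s+t}$), Borel measurable transition function, $\mathbb{P}_x(X_0=x)=1$, and $\mathbb{P}_x(X_t\in E)=1$ for all $t,x$ (no killing or explosion). $(\mathscr{F}_t)$ is the filtration generated by $X$, completed with the $\mathbb{P}_\mu$-null sets for all initial distributions $\mu$ (the minimum augmented admissible filtration, which is right-continuous). A process is called a semimartingale/martingale if it is one under $\mathbb{P}_x$ for every $x\in E$. Pricing kernel: $S=(S_t)_{t\ge0}$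 is a strictly positive semimartingale with $S_0=1$, strictly positive left limits $S_->0$, the multiplicative property $S_{t+s}(\omega)=S_t(\omega)S_s(\theta_t\omega)$, and $\mathbb{E}^{\mathbb P}_x[S_t]<\infty$ for all $t>0$, $x\in E$. Eigen-measure: if $\pi$ ($0<\pi(x)<\infty$ Borel) satisfies $\mathscr{P}_t\pi=e^{-\lambda t}\pi$ for all $t$, then $M^\pi_t=e^{\lambda t}\frac{\pi(X_t)}{\pi(X_0)}S_t$ is a positive $\mathbb{P}_x$-martingale with $M_0^\pi=1$ for every $x$, and $\mathbb{Q}^\pi=(\mathbb{Q}^\pi_x)_{x\in E}$ is defined by $\mathbb{Q}^\pi_x|_{\mathscr{F}_t}=M^\pi_t\,\mathbb{P}_x|_{\mathscr{F}_t}$. Under $\mathbb{Q}^\pi$ the transition function of $X$ is $Q^\pi_t(x,B)=\mathbb{E}^{\mathbb P}_x[M^\pi_t 1_B(X_t)]=e^{\lambda t}\pi(x)^{-1}\mathscr{P}_t(\pi 1_B)(x)$. Recurrence: the potential measure of $X$ under a family of laws with transition function $P_t(x,\cdot)$ is $R(x,B)=\int_0^\infty P_t(x,B)\,dt$ (the expected total time spent in $B$ starting from $x$). $X$ is recurrent if for each $B\in\mathscr{E}^*$ either $R(x,B)=0$ for all $x\in E$ or $R(x,B)=\infty$ for all $x\in E$. *)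

(* Defs.v *)
From HB Require Import structures.
From mathcomp Require Import all_boot all_order all_algebra.
From mathcomp Require Import all_classical all_reals all_analysis.
From mathcomp Require Import measurable_realfun.

Set Implicit Arguments.
Unset Strict Implicit.
Unset Printing Implicit Defensive.

Import Order.TTheory GRing.Theory Num.Theory.
Import numFieldNormedType.Exports.

Local Open Scope classical_set_scope.
Local Open Scope ring_scope.

(* Processes are functions R -> Omega -> _ of which only the values at times
   t >= 0 are ever used. *)

Notation borel E := (g_sigma_algebraType (@open E)).

Definition lusin_space (R : realType) (E : topologicalType) : Prop :=
  exists (K : metricType R) (f : E -> K),
    [/\ compact [set: K],
        injective f,
        (<<s @open K >>) (range f) &
        forall U : set E, open U <-> exists2 V : set K, open V & U = f @^-1` V].

Definition universally_measurable (R : realType) (E : ptopologicalType)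
    (B : set E) : Prop :=
  forall mu : probability (borel E) R, exists B1 B2 : set (borel E),
    [/\ measurable B1, measurable B2, B1 `<=` B, B `<=` B2 &
        mu (B2 `\` B1) = 0%E].

Section stochastic_basis.
Context {R : realType} d {Omega : measurableType d}.
Implicit Types (G : R -> set (set Omega)) (Q : probability Omega R).
Implicit Types (Y M A : R -> Omega -> R) (T : Omega -> \bar R).

Definition adapted G Y : Prop :=
  forall t : R, 0 <= t -> forall B : set R, measurable B -> G t (Y t @^-1` B).

Definition cadlag (f : R -> R) : Prop :=
  (forall t : R, 0 <= t -> f s @[s --> t^'+] --> f t) /\
  (forall t : R, 0 < t -> cvg (f s @[s --> t^'-])).

Definition stopping_time G T : Prop :=
  (forall w, (0 <= T w)%E) /\
  (forall t : R, 0 <= t -> G t [set w | (T w <= t%:E)%E]).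

Definition stopped_sigma_field G T : set (set Omega) :=
  [set B : set Omega | measurable B /\
    forall t : R, 0 <= t -> G t (B `&` [set w | (T w <= t%:E)%E])].

Definition stopped_process Y T : R -> Omega -> R :=
  fun t w => Y (fine (Order.min t%:E (T w))) w.

Definition martingale G Q M : Prop :=
  [/\ adapted G M,
      forall t : R, 0 <= t -> Q.-integrable setT (EFin \o M t) &
      forall s t : R, 0 <= s -> s <= t -> forall B : set Omega, G s B ->
        (\int[Q]_(w in B) (M t w)%:E = \int[Q]_(w in B) (M s w)%:E)%E].

(* Paths are only required to be regular Q-almost surely because the filtration
   need not contain all the subsets of Q-negligible sets. *)
Definition local_martingale G Q M : Prop :=
  [/\ adapted G M,
      {ae Q, forall w, cadlag (fun t => M t w)} &
      exists T : nat -> Omega -> \bar R,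
        [/\ forall n, stopping_time G (T n),
            {ae Q, forall w, nondecreasing_seq (fun n => T n w) /\
                             T n w @[n --> \oo] --> +oo%E} &
            forall n, martingale G Q
              (stopped_process (fun t w => M t w - M 0 w) (T n))]].

Definition finite_variation_process G Q A : Prop :=
  adapted G A /\
  {ae Q, forall w, cadlag (fun t => A t w) /\
    forall t : R, 0 <= t -> bounded_variation 0 t (fun s => A s w)}.

Definition semimartingale G Q Y : Prop :=
  adapted G Y /\
  exists M A, [/\ local_martingale G Q M, finite_variation_process G Q A &
    {ae Q, forall w, [/\ M 0 w = 0, A 0 w = 0 &
      forall t : R, 0 <= t -> Y t w = Y 0 w + M t w + A t w]}].

End stochastic_basis.

Section markov_process.
Context {R : realType} {E : ptopologicalType} d {Omega : measurableType d}.
Variables (P : E -> probability Omega R) (X : R -> Omega -> E).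

Definition natural_field (t : R) : set (set Omega) :=
  <<s [set C | exists (s : R) (B : set (borel E)),
        [/\ 0 <= s, s <= t, measurable B & C = X s @^-1` B]] >>.

Definition natural_field_infty : set (set Omega) :=
  <<s [set C | exists (s : R) (B : set (borel E)),
        [/\ 0 <= s, measurable B & C = X s @^-1` B]] >>.

(* [\int[mu]_x P x N] is P_mu(N), the law P_mu having initial distribution mu;
   a set is in the augmentation of G when, for every mu, it differs from an
   element of G by a subset of a P_mu-null set of the natural sigma-field. *)
Definition augmentation (G : set (set Omega)) : set (set Omega) :=
  [set A | forall mu : probability (borel E) R, exists B N : set Omega,
    [/\ G B, natural_field_infty N, (\int[mu]_x P x N = 0)%E &
        A `+` B `<=` N]].

Definition augmented_filtration (t : R) : set (set Omega) :=
  augmentation (natural_field t).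

Record borel_right_process (theta : R -> Omega -> Omega) : Prop := {
  brp_sigma_field : @measurable d Omega = augmentation natural_field_infty ;
  brp_right_continuous_filtration : forall t : R, 0 <= t ->
    \bigcap_(s in [set s : R | t < s]) augmented_filtration s
      `<=` augmented_filtration t ;
  brp_right_continuous_paths : forall w (t : R), 0 <= t ->
    X s w @[s --> t^'+] --> X t w ;
  brp_shift : forall (s t : R) w, 0 <= s -> 0 <= t ->
    X s (theta t w) = X (s + t) w ;
  brp_start : forall x, P x [set w | X 0 w = x] = 1%E ;
  brp_borel_transition : forall (t : R) (B : set (borel E)), 0 <= t -> measurable B ->
    measurable_fun [set: borel E]
      ((fun x => P x (X t @^-1` B)) : borel E -> \bar R) ;
  brp_strong_markov : forall x (T : Omega -> \bar R) (A L : set Omega),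
    stopping_time augmented_filtration T ->
    stopped_sigma_field augmented_filtration T A ->
    natural_field_infty L ->
    (P x (A `&` [set w | T w < +oo /\ L (theta (fine (T w)) w)])
     = \int[P x]_(w in A `&` [set w | T w < +oo])
         P (X (fine (T w)) w) L)%E
}.

Record pricing_kernel (theta : R -> Omega -> Omega) (S : R -> Omega -> R)
    : Prop := {
  pk_semimartingale : forall x, semimartingale augmented_filtration (P x) S ;
  pk_gt0 : forall (t : R) w, 0 <= t -> 0 < S t w ;
  pk_start : forall w, S 0 w = 1 ;
  pk_left_limit_gt0 : forall x, {ae P x, forall w, forall t : R, 0 < t ->
    exists2 l : R, 0 < l & S s w @[s --> t^'-] --> l} ;
  pk_multiplicative : forall (s t : R) w, 0 <= s -> 0 <= t ->
    S (t + s) w = S t w * S s (theta t w) ;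
  pk_integrable : forall (t : R) x, 0 < t -> ('E_(P x)[S t] < +oo)%E
}.

Variable S : R -> Omega -> R.

Definition pricing_operator (t : R) (f : E -> R) (x : E) : \bar R :=
  'E_(P x)[(fun w => S t w * f (X t w))%R]%E.

Definition eigen_martingale (pi : E -> R) (lambda t : R) (w : Omega) : R :=
  expR (lambda * t) * (pi (X t w) / pi (X 0 w)) * S t w.

(* The value on A, for A in the sigma-field of time t, of the law with density
   [eigen_martingale pi lambda t] with respect to P x at that time.  A single
   measure on the whole sigma-field of Omega with these restrictions need not
   exist, since the augmented filtration contains all the P-null events of the
   infinite horizon; hence the explicit dependence on t. *)
Definition eigen_law (pi : E -> R) (lambda t : R) (x : E) (A : set Omega)
    : \bar R :=
  (\int[P x]_(w in A) (eigen_martingale pi lambda t w)%:E)%E.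

Definition eigen_transition (pi : E -> R) (lambda t : R) (x : E) (B : set E)
    : \bar R :=
  eigen_law pi lambda t x (X t @^-1` B).

End markov_process.

Section recurrence.
Context {R : realType} {E : ptopologicalType}.
Variable Q : R -> E -> set E -> \bar R.

(* For B universally measurable, [t |-> Q t x B] is in general only
   Lebesgue measurable; the integral of a nonnegative function being the
   supremum of the integrals of the simple Borel functions below it, it is then
   the usual Lebesgue integral. *)
Definition potential (x : E) (B : set E) : \bar R :=
  (\int[@lebesgue_measure R]_(t in [set t | (0 <= t)%R]) Q t x B)%E.

Definition recurrent : Prop :=
  forall B : set E, universally_measurable R B ->
    (forall x, potential x B = 0%E) \/ (forall x, potential x B = +oo%E).

End recurrence.

Section recurrent_eigenfunction.
Context {R : realType} {E : ptopologicalType} d {Omega : measurableType d}.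
Variables (P : E -> probability Omega R) (X : R -> Omega -> E).
Variable S : R -> Omega -> R.

Definition positive_borel (pi : E -> R) : Prop :=
  measurable_fun [set: borel E] (pi : borel E -> R) /\ forall x, 0 < pi x.

Definition eigenfunction (pi : E -> R) (lambda : R) : Prop :=
  forall (t : R) x, 0 < t ->
    pricing_operator P X S t pi x = (expR (- lambda * t) * pi x)%:E.

Definition recurrent_eigenfunction (pi : E -> R) : Prop :=
  positive_borel pi /\
  exists2 lambda : R, eigenfunction pi lambda &
    recurrent (eigen_transition P X S pi lambda).

End recurrent_eigenfunction.

(* Main.v *)
(** If [pi1], [pi2] are recurrent eigenfunctions with exponents [l1 <= l2], let
    [k := pi1 * pi2 / (pi1 + pi2)].  As a concave 1-homogeneous function of
    [(pi1, pi2)], [k] lies below its tangent planes, so that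
    [V t x := e^(l1 t) P_t k x] is bounded by [k x] and nonincreasing in [t].
    Hence [k - V n] has a finite potential under [Q^pi1], up to the factor
    [pi1], and recurrence makes [V n = k] off a set of potential zero.  At a
    point [x1] off these sets equality holds in the tangent inequality, which
    forces [pi2 / pi1 = pi2 x1 / pi1 x1] on almost every [X s] started at [x1].
    The set where this fails has zero potential from [x1], hence from every
    point, and the eigenvalue equations give proportionality everywhere.

    [P_s k] is only universally measurable.  It is replaced by a Borel version
    for the law of [X] at an independent Gaussian time, which charges every set
    visited during a set of times of positive Lebesgue measure. *)

Require Import Defs.
From HB Require Import structures.
From mathcomp Require Import all_boot all_order all_algebra.
From mathcomp Require Import all_classical all_reals all_analysis.
From mathcomp Require Import measurable_realfun ring.
Import Order.TTheory GRing.Theory Num.Theory.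
Import numFieldNormedType.Exports.
Local Open Scope classical_set_scope.
Local Open Scope ring_scope.
Set Implicit Arguments.
Unset Strict Implicit.
Unset Printing Implicit Defensive.

(** With [h = pi2 / pi1], the quotient [k / pi1] is [h / (1 + h)]. When [l1 <= l2], [h (X t)] is a
    positive supermartingale under Q^pi1. The classical argument makes such a function constant by
    truncating it at every level; one bounded, strictly concave function of [h] replaces all the
    truncations, and equality at a single point already identifies the ratio. The finite potential
    comes from telescoping: e^(l1 t) P_t (k - V n) = V t - V (t + n), and the integral of the right
    side over all times is at most that of V over [0, n]. Since recurrence speaks of sets, this
    bound is applied to the sets where [k - V n] is at least [pi1 / (j + 1)]. What shapes the rest
    is measurability. S is adapted only to the augmented filtration and right-continuous only almost
    surely, while potentials integrate over time and the Markov property produces functions of the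
    starting point that have to be Borel. *)

(** * Induction on nonnegative measurable functions *)

Section measurable_functions.
Context {R : realType} d (T : measurableType d).

Import HBNNSimple.

(** The increasing dyadic approximations of [f] are finite sums of indicators with nonnegative
    coefficients; the single closure under [c * f + g] builds these sums one term at a time. *)
Lemma ge0_measurable_ind (Pr : (T -> \bar R) -> Prop) :
  (forall A, measurable A -> Pr (fun x => (\1_A x)%:E)) ->
  (forall (c : R) (f g : T -> \bar R), 0 <= c ->
     measurable_fun setT f -> measurable_fun setT g ->
     (forall x, (0 <= f x)%E) -> (forall x, (0 <= g x)%E) -> Pr f -> Pr g ->
     Pr (fun x => (c%:E * f x + g x)%E)) ->
  (forall (f_ : (T -> \bar R)^nat) (f : T -> \bar R),
     (forall n, measurable_fun setT (f_ n)) ->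
     (forall n x, (0 <= f_ n x)%E) ->
     (forall x, nondecreasing_seq (f_ ^~ x)) ->
     (forall x, f_ ^~ x @ \oo --> f x) ->
     (forall n, Pr (f_ n)) -> Pr f) ->
  forall f, measurable_fun setT f -> (forall x, (0 <= f x)%E) -> Pr f.
Proof.
move=> Pindic Pcomb Plim f mf f0.
have Psum (c : nat -> R) (A : nat -> set T) n : (forall k, 0 <= c k) ->
    (forall k, measurable (A k)) ->
    Pr (fun x => (\sum_(k < n) c k * \1_(A k) x)%:E).
  move=> c0 mA; elim: n => [|n IHn].
    rewrite (_ : (fun _ => _) = (fun x => (\1_(set0 : set T) x)%:E)).
      exact: Pindic.
    by apply/funext => x; rewrite big_ord0 indic0.
  rewrite (_ : (fun _ => _) = (fun x => ((c n)%:E * (\1_(A n) x)%:E +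
      (\sum_(k < n) c k * \1_(A k) x)%:E)%E)).
    apply: Pcomb; [exact: c0| | | | | |exact: IHn].
    - by apply/measurable_EFinP; apply: measurable_indic.
    - apply/measurable_EFinP; apply: measurable_sum => k.
      by apply: measurable_funM => //; exact: measurable_indic.
    - by move=> x; rewrite lee_fin.
    - by move=> x; rewrite lee_fin; apply: sumr_ge0 => k _; exact: mulr_ge0.
    - exact: Pindic.
  by apply/funext => x; rewrite big_ord_recr/= EFinD addeC EFinM.
have approxE n : approx setT f n = nnsfun_approx measurableT mf n :> (T -> R).
  by rewrite nnsfun_approxE.
apply: (Plim (fun n x => (approx setT f n x)%:E)).
- by move=> n; apply/measurable_EFinP; rewrite approxE.
- by move=> n x; rewrite lee_fin approxE.
- by move=> x m n mn; rewrite lee_fin; exact/lefP/nd_approx.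
- by move=> x; apply: ecvg_approx.
move=> n; rewrite /approx.
(* The approximation at level [n] has [N] dyadic layers and a cap of height [n] on the set where [f]
   is at least [n]; index [N] carries the cap, so that one sum of [N.+1] terms covers both. *)
pose N := (n * 2 ^ n)%N.
pose c k : R := if (k < N)%N then k%:R * 2 ^- n else n%:R.
pose A k := if (k < N)%N then dyadic_approx setT f n k else integer_approx setT f n.
rewrite (_ : (fun _ => _) = (fun x => (\sum_(k < N.+1) c k * \1_(A k) x)%:E)).
  apply: Psum => k; rewrite /c /A; case: ifPn => kN//.
    rewrite /dyadic_approx kN; rewrite -preimage_comp.
    by apply: (mf) => //; apply/measurable_image_EFin; exact: measurable_itv.
  by rewrite /integer_approx; exact: emeasurable_fun_c_infty.
apply/funext => x /=; rewrite big_ord_recr/= /c /A ltnn; congr (_ + _)%:E.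
by apply: eq_bigr => k _; rewrite ltn_ord.
Qed.

End measurable_functions.

(** * Joint measurability of right-continuous processes *)

(** Time is rounded up to the grid of mesh [1 / n.+1], so the space is a countable union of slabs on
    each of which a single [Y t] is read. Negative times are clamped to 0, where alone [Y] is
    controlled. *)
Lemma measurable_fun_nat_disc {R : realType} d (T : measurableType d)
    (Y : R -> T -> \bar R) (n : nat) :
  (forall t, 0 <= t -> measurable_fun setT (Y t)) ->
  measurable_fun setT (fun z : R * T =>
    Y ((Num.truncn (n.+1%:R * Num.max z.1 0)).+1%:R / n.+1%:R) z.2).
Proof.
move=> mY.
pose c (z : R * T) : R := n.+1%:R * Num.max z.1 0.
have c0 z : 0 <= c z by rewrite mulr_ge0// le_max lexx orbT.
have mc : measurable_fun setT c.
  apply: measurable_funM => //.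
  exact: (@measurable_maxr _ _ R setT fst (cst 0)).
pose D k : set (R * T) := c @^-1` `[k%:R, k.+1%:R[.
have mD k : measurable (D k) by rewrite -[D k]setTI; exact: mc.
have -> : [set: R * T] = \bigcup_k D k.
  apply/seteqP; split=> // z _; exists (Num.truncn (c z)) => //=.
  by rewrite /D/= in_itv/= truncn_itv.
apply/measurable_fun_bigcup => // k.
apply: (eq_measurable_fun (fun z => Y (k.+1%:R / n.+1%:R) z.2)).
  by move=> z /[!inE]; rewrite /D/= in_itv/= -/(c z) => /truncn_def ->.
apply: measurable_funTS; apply: measurableT_comp; last exact: measurable_snd.
by apply: mY; rewrite divr_ge0.
Qed.

(** The successor of the truncation is strictly larger than [n.+1 * t], even at grid points: the
    filter of right neighbourhoods excludes [t] itself. The error is at most [1 / n.+1]. *)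
Lemma cvg_nat_disc {R : realType} (t : R) : 0 <= t ->
  (Num.truncn (n.+1%:R * t)).+1%:R / n.+1%:R @[n --> \oo] --> t^'+.
Proof.
move=> t0 A [e /= e0 eA].
suff : \forall n \near \oo, A ((Num.truncn (n.+1%:R * t)).+1%:R / n.+1%:R) by [].
near=> n.
have n0 : 0 < n.+1%:R :> R by [].
have nt0 : 0 <= n.+1%:R * t by rewrite mulr_ge0.
have /andP[lo hi] := truncn_itv nt0.
have lt1 : t < (Num.truncn (n.+1%:R * t)).+1%:R / n.+1%:R.
  by rewrite ltr_pdivlMr// mulrC.
apply: eA => //=.
rewrite distrC ger0_norm ?subr_ge0 ?(ltW lt1)// ltrBlDr.
apply: (@le_lt_trans _ _ (t + n.+1%:R^-1)).
  rewrite ler_pdivrMr// mulrDl mulVf ?gt_eqF// -natr1 lerD2r.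
  by rewrite (le_trans lo)// mulrC.
rewrite addrC ltrD2r.
by near: n; exact: (near_infty_natSinv_lt (PosNum e0)).
Unshelve. all: by end_near. Qed.

Lemma measurable_fun_right_continuous {R : realType} d (T : measurableType d)
    (Y : R -> T -> \bar R) :
  (forall t, 0 <= t -> measurable_fun setT (Y t)) ->
  (forall w t, 0 <= t -> Y s w @[s --> t^'+] --> Y t w) ->
  measurable_fun setT (fun z : R * T => Y (Num.max z.1 0) z.2).
Proof.
move=> mY cY; apply: (emeasurable_fun_cvg (fun n (z : R * T) =>
    Y ((Num.truncn (n.+1%:R * Num.max z.1 0)).+1%:R / n.+1%:R) z.2)).
  by move=> n; exact: measurable_fun_nat_disc.
move=> z _.
have z0 : 0 <= Num.max z.1 0 by rewrite le_max lexx orbT.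
exact: cvg_comp (cvg_nat_disc z0) (cY z.2 _ z0).
Qed.

(** The function is the distance to the complement in the ambient metric space. Its value [+oo] for
    an empty complement covers the case of the whole space. Through it, measurability of maps into
    [E] reduces to that of numerical functions. *)
Lemma lusin_open_pos {R : realType} {E : ptopologicalType} (U : set E) :
  lusin_space R E -> open U ->
  exists2 g : E -> \bar R, continuous g & U = [set x | (0 < g x)%E].
Proof.
move=> [K [f [_ _ _ openE]]] /openE[V oV UV].
exists (edist_inf (~` V) \o f).
  move=> x; apply: continuous_comp; last exact: edist_inf_continuous.
  move: x; apply/continuousP => A oA; apply/openE; by exists A.
apply/seteqP; split=> x; rewrite UV /=.
  move=> Vfx; have : nbhs (f x) V by exact: open_nbhs_nbhs.
  move=> /nbhs_ballP[e /= e0 eV].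
  apply: (@lt_le_trans _ _ e%:E); first by rewrite lte_fin.
  apply: le_ereal_inf_tmp => _ [a VCa <-]; rewrite leNgt; apply/negP.
  by move=> /edist_lt_ball /= /eV.
by apply: contraPP => nVfx; rewrite (@edist_inf0 _ _ (~` V))// ltxx.
Qed.

Lemma lusin_measurable1 {R : realType} {E : ptopologicalType} (x : E) :
  lusin_space R E -> @measurable _ (borel E) [set x].
Proof.
move=> [K [f [_ fI _ openE]]]; rewrite -[X in measurable X]setCK.
apply: measurableC; apply: sub_sigma_algebra; apply/openE.
exists (~` [set f x]).
  apply: closed_openC; apply: accessible_closed_set1; apply: hausdorff_accessible.
  exact: metric_hausdorff.
by apply/seteqP; split=> y /= yx; [move=> /fI|move=> xy; apply: yx; rewrite xy].
Qed.

Lemma measurable_fun_right_continuous_lusin {R : realType} {E : ptopologicalType}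
    d (T : measurableType d) (X : R -> T -> E) :
  lusin_space R E ->
  (forall t, 0 <= t -> measurable_fun setT (X t : T -> borel E)) ->
  (forall w t, 0 <= t -> X s w @[s --> t^'+] --> X t w) ->
  measurable_fun setT ((fun z : R * T => X (Num.max z.1 0) z.2) : _ -> borel E).
Proof.
move=> lE mX cX.
apply: (@measurability _ _ _ (borel E) _ _ (@open E)) => // _ [U oU <-].
have [g cg ->] := lusin_open_pos lE oU.
rewrite setTI.
have mg : measurable_fun setT (g : borel E -> \bar R).
  refine (@measurability _ _ (borel E) (\bar R) setT (g : borel E -> \bar R) _
    (ErealGenOInfty.measurableE R) _).
  move=> _ [_ [r ->] <-]; rewrite setTI; apply: sub_sigma_algebra.
  have /continuousP := cg; apply.
  by rewrite set_itvoy; exact: open_ereal_gt_ereal.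
have mgX : measurable_fun setT (fun z : R * T => g (X (Num.max z.1 0) z.2)).
  apply: (@measurable_fun_right_continuous _ _ _ (fun t w => g (X t w))).
    by move=> t t0; exact: measurableT_comp mg (mX t t0).
  by move=> w t t0; apply: (cvg_comp _ _ (cX w t t0)); exact: cg.
have := emeasurable_fun_o_infty measurableT mgX 0%E.
by rewrite setTI.
Qed.

(** * Laws of the process *)

Section measurable_integral.
Context {R : realType} d1 d2 d3 (T1 : measurableType d1) (T2 : measurableType d2)
  (T3 : measurableType d3).
Variables (m : T1 -> {measure set T2 -> \bar R}) (phi : T2 -> T3).
Hypothesis mphi : measurable_fun setT phi.

(** Measurability in [y] is asked only for preimages under [phi]: for a general measurable event of
    [Omega], which lies in an augmentation, [m y] need not depend on [y] in a Borel way. *)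
Lemma measurable_fun_integral_comp (f : T3 -> \bar R) :
  (forall A, measurable A -> measurable_fun setT (fun y => m y (phi @^-1` A))) ->
  measurable_fun setT f -> (forall z, (0 <= f z)%E) ->
  measurable_fun setT (fun y => (\int[m y]_w f (phi w))%E).
Proof.
move=> mm; move: f; apply: ge0_measurable_ind.
- move=> A mA; have mphiA : measurable (phi @^-1` A).
    by rewrite -[X in measurable X]setTI; exact: mphi.
  rewrite (_ : (fun _ => _) = fun y => m y (phi @^-1` A)); first exact: mm.
  by apply/funext => y; rewrite (integral_indic (m y) measurableT mphiA) setIT.
- move=> c f g c0 mf mg f0 g0 mif mig.
  rewrite (_ : (fun _ => _) =
      fun y => (c%:E * (\int[m y]_w f (phi w)) + \int[m y]_w g (phi w))%E).
    by apply: emeasurable_funD => //; exact: measurable_funeM.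
  apply/funext => y; rewrite ge0_integralD//.
  + by rewrite ge0_integralZl_EFin//; exact: measurableT_comp.
  + by move=> w _; rewrite mule_ge0.
  + by apply: measurable_funeM; exact: measurableT_comp.
  + exact: measurableT_comp.
- move=> f_ f mf f0 ndf cf mif.
  apply: (emeasurable_fun_cvg (fun n y => (\int[m y]_w f_ n (phi w))%E)) => // y _.
  have -> : (\int[m y]_w f (phi w))%E = (\int[m y]_w limn (f_ ^~ (phi w)))%E.
    by apply: eq_integral => w _; apply/esym/cvg_lim => //; exact: cf.
  apply: cvg_monotone_convergence => //.
  by move=> n; exact: measurableT_comp.
Qed.

End measurable_integral.

Section right_process.
Context {R : realType} {E : ptopologicalType} d {Omega : measurableType d}.
Variables (P : E -> probability Omega R) (X : R -> Omega -> E).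
Variable theta : R -> Omega -> Omega.
Hypothesis X_right : borel_right_process P X theta.

Lemma natural_field_infty_measurable (A : set Omega) :
  natural_field_infty X A -> measurable A.
Proof.
move=> nA; rewrite (brp_sigma_field X_right) => mu; exists A, set0; split=> //.
- exact: sigma_algebra0.
- by apply: integral0_eq => x _; rewrite measure0.
- by rewrite setYK.
Qed.

Lemma measurable_process (t : R) : 0 <= t ->
  measurable_fun setT (X t : Omega -> borel E).
Proof.
move=> t0 _ B mB; rewrite setTI; apply: natural_field_infty_measurable.
by apply: sub_sigma_algebra; exists t, B.
Qed.

Lemma sub_natural_field_infty (t : R) : natural_field X t `<=` natural_field_infty X.
Proof.
apply: sub_sigma_algebra2 => C [s [B [s0 st mB ->]]].
by exists s, B.
Qed.

Lemma natural_field_mono (s t : R) : s <= t -> natural_field X s `<=` natural_field X t.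
Proof.
move=> st; apply: sub_sigma_algebra2 => C [r [B [r0 rs mB ->]]].
by exists r, B; split=> //; exact: le_trans st.
Qed.

Lemma augmentation_mono (G H : set (set Omega)) : G `<=` H ->
  augmentation P X G `<=` augmentation P X H.
Proof.
move=> GH A augA mu; have [B [N [GB nN PN AB]]] := augA mu.
by exists B, N; split=> //; exact: GH.
Qed.

Lemma sub_augmentation (G : set (set Omega)) : G `<=` augmentation P X G.
Proof.
move=> A GA mu; exists A, set0; split=> //.
- exact: sigma_algebra0.
- by apply: integral0_eq => x _; rewrite measure0.
- by rewrite setYK.
Qed.

Lemma augmented_filtration_measurable (t : R) (A : set Omega) :
  augmented_filtration P X t A -> measurable A.
Proof.
rewrite (brp_sigma_field X_right); apply: augmentation_mono.
exact: sub_natural_field_infty.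
Qed.

(** This is the strong Markov property at the constant stopping time [t]. The past event may lie in
    the augmented field, since S is adapted to nothing smaller. *)
Lemma markov_set (x : E) (t : R) (A L : set Omega) : 0 <= t ->
  augmented_filtration P X t A -> natural_field_infty X L ->
  P x (A `&` theta t @^-1` L) = (\int[P x]_(w in A) P (X t w) L)%E.
Proof.
move=> t0 augA nL.
have augT s : augmented_filtration P X s setT.
  apply: sub_augmentation.
  by rewrite -setC0; apply: sigma_algebraC; exact: sigma_algebra0.
have aug0 s : augmented_filtration P X s set0.
  by apply: sub_augmentation; exact: sigma_algebra0.
have Ts s : [set w : Omega | (cst t%:E w <= s%:E)%E] =
    if t <= s then setT else set0.
  by rewrite /= lee_fin; case: ifPn => ts; apply/seteqP; split=> w //=;
    rewrite (negbTE ts).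
have := @brp_strong_markov _ _ _ _ _ _ _ X_right x (cst t%:E) A L.
rewrite /= ltry.
have -> : [set w : Omega | (true : Prop) /\ L (theta t w)] = theta t @^-1` L.
  by apply/seteqP; split=> w /= => [[]|].
have -> : [set w : Omega | is_true true] = setT by apply/seteqP; split.
rewrite setIT; apply=> //.
- split=> [w|s s0]; first by rewrite lee_fin.
  by rewrite Ts; case: ifP.
- split=> [|s s0]; first exact: augmented_filtration_measurable augA.
  rewrite Ts; case: ifPn => [ts|_]; last by rewrite setI0.
  rewrite setIT.
  by move: A augA; apply: augmentation_mono; exact: natural_field_mono.
Qed.

(** Finite-dimensional events, with times in any order, so that intersection is concatenation of
    lists; they form the generating pi-system of the natural sigma-field. *)
Definition cylinder (l : seq (R * set E)) : set Omega :=
  [set w | forall p, p \in l -> p.2 (X p.1 w)].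

Definition cylinder_wf (l : seq (R * set E)) : Prop :=
  forall p, p \in l -> 0 <= p.1 /\ @measurable _ (borel E) p.2.

Lemma cylinder_cons (p : R * set E) l :
  cylinder (p :: l) = X p.1 @^-1` p.2 `&` cylinder l.
Proof.
apply/seteqP; split=> w /=.
  by move=> H; split=> [|q ql]; apply: H; rewrite inE ?eqxx ?ql ?orbT.
by move=> [pw H] q; rewrite inE => /predU1P[->//|]; exact: H.
Qed.

Lemma cylinder_natural l : cylinder_wf l -> natural_field_infty X (cylinder l).
Proof.
elim: l => [_|p l IHl wf].
  rewrite (_ : cylinder _ = setT); last by apply/seteqP; split.
  by rewrite -setC0; apply: sigma_algebraC; exact: sigma_algebra0.
rewrite cylinder_cons.
have := @measurableI _ (g_sigma_algebraType [set C | exists (s : R) (B : set (borel E)),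
        [/\ 0 <= s, measurable B & C = X s @^-1` B]]); apply.
- have [p0 mp] := wf p (mem_head _ _).
  by apply: sub_sigma_algebra; exists p.1, p.2.
- by apply: IHl => q ql; apply: wf; rewrite inE ql orbT.
Qed.

End right_process.

Section path_laws.
Context {R : realType} {E : ptopologicalType} d {Omega : measurableType d}.
Variables (P : E -> probability Omega R) (X : R -> Omega -> E).
Variable theta : R -> Omega -> Omega.
Hypothesis X_right : borel_right_process P X theta.

(** Once the earliest constraint is split off, the others constrain the shifted path at times
    counted from [p.1]; sorting keeps these times nonnegative. *)
Lemma cylinder_sorted_cons (p : R * set E) l :
  cylinder_wf (p :: l) -> sorted (fun q r => q.1 <= r.1) (p :: l) ->
  let l' := [seq (q.1 - p.1, q.2) | q <- l] in
  [/\ cylinder_wf l', sorted (fun q r => q.1 <= r.1) l' &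
      cylinder X (p :: l) = X p.1 @^-1` p.2 `&` theta p.1 @^-1` cylinder X l'].
Proof.
move=> wf so l'.
have [p0 _] := wf p (mem_head _ _).
have tr : transitive (fun q r : R * set E => q.1 <= r.1).
  by move=> y x z; exact: le_trans.
have ple q : q \in l -> p.1 <= q.1 by move/allP: (order_path_min tr so) => /[apply].
split.
- move=> _ /mapP[q ql ->] /=; rewrite subr_ge0 ple//; split=> //.
  by have [] := wf q; rewrite // inE ql orbT.
- rewrite sorted_map; move: (path_sorted so); apply: sub_sorted => q r /=.
  by rewrite lerD2r.
rewrite cylinder_cons; congr (_ `&` _); apply/seteqP; split=> w /= H.
  move=> _ /mapP[q ql ->] /=.
  by rewrite (brp_shift X_right) ?subr_ge0 ?ple// subrK; exact: H.
move=> q ql; have := H (q.1 - p.1, q.2); rewrite /=.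
rewrite (brp_shift X_right) ?subr_ge0 ?ple// subrK; apply.
by apply/mapP; exists q.
Qed.

Lemma measurable_transition (f : borel E -> \bar R) (t : R) : 0 <= t ->
  measurable_fun setT f -> (forall y, (0 <= f y)%E) ->
  measurable_fun setT ((fun y => (\int[P y]_w f (X t w))%E) : borel E -> \bar R).
Proof.
move=> t0 mf f0.
apply: (@measurable_fun_integral_comp _ _ _ _ (borel E) Omega (borel E)
  (fun y => P y : {measure set Omega -> \bar R}) (X t)) => //.
  exact: measurable_process X_right _ t0.
by move=> A mA; exact: brp_borel_transition X_right _ _ t0 mA.
Qed.

Lemma measurable_law_cylinder l : cylinder_wf l ->
  measurable_fun setT ((fun y => P y (cylinder X l)) : borel E -> \bar R).
Proof.
move=> wfl.
pose leT := fun q r : R * set E => q.1 <= r.1.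
have -> : cylinder X l = cylinder X (sort leT l).
  by apply/seteqP; split=> w H p pl; apply: H; move: pl; rewrite mem_sort.
have : cylinder_wf (sort leT l) by move=> p; rewrite mem_sort; exact: wfl.
have : sorted leT (sort leT l).
  by apply: sort_sorted => q r; exact: le_total.
move: (sort leT l) => {l wfl}.
(* The induction is on the length because the Markov property leaves a time-shifted copy of the
   tail, not the tail itself. *)
move=> l; have [n nl] := ubnP (size l); elim: n => // n IHn in l nl *.
case: l nl => [_ _ _|p l nl so wf].
  rewrite (_ : cylinder X [::] = setT); last by apply/seteqP; split.
  by rewrite (_ : (fun _ => _) = cst 1%E)//; apply/funext => y; rewrite probability_setT.
have [wf' so' ->] := cylinder_sorted_cons wf so.
set l' := map _ _ in wf' so' *.
have [p0 mp] := wf p (mem_head _ _).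
have mf := IHn l' _ so' wf'.
have -> : (fun y => P y (X p.1 @^-1` p.2 `&` theta p.1 @^-1` cylinder X l')) =
    (fun y => \int[P y]_w ((fun z => P z (cylinder X l')) \_ p.2) (X p.1 w))%E.
  apply/funext => y; rewrite (markov_set X_right)//.
  - by rewrite integral_mkcond; apply: eq_integral => w _; rewrite !patchE.
  - apply: sub_augmentation; apply: sub_sigma_algebra.
    by exists p.1, p.2.
  - exact: cylinder_natural.
apply: measurable_transition => //.
- apply/(@measurable_restrict _ _ (borel E) _ p.2 setT) => //.
  rewrite setTI; apply: measurable_funTS; apply: mf.
  by rewrite size_map.
- by move=> y; rewrite erestrict_ge0.
Qed.

(** Only the one-time transition probabilities are assumed Borel. Cylinders inherit this from the
    Markov property, and the pi-lambda theorem extends it to the whole uncompleted field. *)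
Lemma measurable_law (L : set Omega) : natural_field_infty X L ->
  measurable_fun setT ((fun y => P y L) : borel E -> \bar R).
Proof.
pose G := [set C | exists2 l, cylinder_wf l & C = cylinder X l].
have GN : <<s G >> `<=` natural_field_infty X.
  apply: smallest_sub; first exact: smallest_sigma_algebra.
  by move=> _ [l wf ->]; exact: cylinder_natural.
have NG : natural_field_infty X `<=` <<s G >>.
  apply: smallest_sub; first exact: smallest_sigma_algebra.
  move=> _ [s [B [s0 mB ->]]]; apply: sub_sigma_algebra.
  exists [:: (s, B)]; first by move=> p; rewrite inE => /eqP ->.
  apply/seteqP; split=> w /=; first by move=> Bw p; rewrite inE => /eqP ->.
  by move=> H; exact: (H (s, B) (mem_head _ _)).
have GM A : <<s G >> A -> measurable A.
  by move=> /GN; exact: (natural_field_infty_measurable X_right).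
move=> /NG; move: L.
apply: (@dynkin_induction _ (g_sigma_algebraType G)) => //.
- move=> _ _ [l wfl ->] [l' wfl' ->]; exists (l ++ l').
    by move=> p; rewrite mem_cat => /orP[]; [exact: wfl|exact: wfl'].
  apply/seteqP; split=> w /=.
    by move=> [H H'] p; rewrite mem_cat => /orP[]; [exact: H|exact: H'].
  by move=> H; split=> p pl; apply: H; rewrite mem_cat pl ?orbT.
- by rewrite (_ : (fun _ => _) = cst 1%E)//; apply/funext => y; rewrite probability_setT.
- by move=> _ [l wfl ->]; exact: measurable_law_cylinder.
- move=> S mS PS.
  rewrite (_ : (fun _ => _) = (fun y => 1 - P y S)%E).
    exact: emeasurable_funB.
  by apply/funext => y; rewrite probability_setC//; exact: GM.
- move=> F mF tF PF.
  rewrite (_ : (fun _ => _) = (fun y => \sum_(0 <= i <oo) P y (F i))%E).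
    exact: ge0_emeasurable_sum.
  apply/funext => y; apply/esym/cvg_lim => //.
  have mF' i : @measurable _ Omega (F i) by apply: GM; exact: mF.
  by apply: measure_semi_sigma_additive => //; exact: bigcupT_measurable.
Qed.

End path_laws.

(** * Markov property *)

Lemma ge0_integral_eq_off_null {R : realType} d (T : measurableType d)
    (mu : {measure set T -> \bar R}) (N : set T) (f g : T -> \bar R) :
  measurable N -> mu N = 0%E -> measurable_fun setT f -> measurable_fun setT g ->
  (forall w, (0 <= f w)%E) -> (forall w, (0 <= g w)%E) ->
  (forall w, ~ N w -> f w = g w) ->
  (\int[mu]_w f w = \int[mu]_w g w)%E.
Proof.
move=> mN N0 mf mg f0 g0 fg; apply: ge0_ae_eq_integral => //.
exists N; split=> // w /= fgw; apply: contrapT => Nw; apply: fgw => _.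
exact: fg.
Qed.

(** Naming the generators turns the uncompleted sigma-field into a measurable type, so that
    functions of the path can be declared measurable for it rather than for its augmentation. *)
Definition natural_generator {R : realType} {E : ptopologicalType} {Omega : Type}
    (X : R -> Omega -> E) : set (set Omega) :=
  [set C | exists (s : R) (B : set (borel E)),
    [/\ 0 <= s, measurable B & C = X s @^-1` B]].

Notation natural_space X := (g_sigma_algebraType (natural_generator X)).

Section markov_property.
Context {R : realType} {E : ptopologicalType} d {Omega : measurableType d}.
Variables (P : E -> probability Omega R) (X : R -> Omega -> E).
Variable theta : R -> Omega -> Omega.
Hypothesis X_right : borel_right_process P X theta.
Variable mu : probability (borel E) R.

Lemma measurable_natural_id :
  measurable_fun setT (id : Omega -> natural_space X).
Proof.
by move=> _ A mA; rewrite setTI; exact: natural_field_infty_measurable X_right _ mA.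
Qed.

Lemma measurable_natural_fun d' (T : measurableType d') (Z : natural_space X -> T) :
  measurable_fun setT Z -> measurable_fun setT (Z : Omega -> T).
Proof. by move=> mZ; exact: measurableT_comp mZ measurable_natural_id. Qed.

Lemma measurable_shift t : 0 <= t ->
  measurable_fun setT (theta t : Omega -> natural_space X).
Proof.
move=> t0; apply: (@measurability _ _ Omega (natural_space X) setT _
  (natural_generator X)) => // _ [_ [s [B [s0 mB ->]]] <-].
rewrite setTI; apply: (natural_field_infty_measurable X_right).
apply: sub_sigma_algebra; exists (s + t), B; split=> //; first exact: addr_ge0.
by apply/seteqP; split=> w /=; rewrite (brp_shift X_right).
Qed.

(** P_mu appears only as an integral, not as a measure; its countable subadditivity is that of each
    [P x], integrated term by term. *)
Lemma bigcup_null (N : (set Omega)^nat) :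
  (forall n, natural_field_infty X (N n)) ->
  (forall n, (\int[mu]_x P x (N n) = 0)%E) ->
  (\int[mu]_x P x (\bigcup_n N n) = 0)%E.
Proof.
move=> nN N0; apply/eqP; rewrite eq_le integral_ge0// andbT.
have mN n : measurable (N n) by exact: natural_field_infty_measurable X_right _ (nN n).
rewrite (@le_trans _ _ (\int[mu]_x (\sum_(n <oo) P x (N n)))%E)//.
  apply: ge0_le_integral => //.
  - by apply: (measurable_law X_right); exact: sigma_algebra_bigcup.
  - by apply: ge0_emeasurable_sum => // n _; exact: measurable_law X_right _ (nN n).
  - move=> x _; apply: measure_sigma_subadditive => //.
    exact: bigcupT_measurable.
rewrite integral_nneseries//; last by move=> n; exact: measurable_law X_right _ (nN n).
by rewrite eseries0// => n _ _; exact: N0.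
Qed.

(* Needed because measurable sets of [Omega] belong only to the augmentation,
   whose elements have no Borel measurable [x |-> P x A] in general. *)
Lemma natural_version (Z : Omega -> \bar R) :
  measurable_fun setT Z -> (forall w, (0 <= Z w)%E) ->
  exists (Z' : Omega -> \bar R) (N : set Omega),
    [/\ measurable_fun setT (Z' : natural_space X -> \bar R),
        forall w, (0 <= Z' w)%E, natural_field_infty X N,
        (\int[mu]_x P x N = 0)%E & forall w, ~ N w -> Z w = Z' w].
Proof.
move: Z; apply: ge0_measurable_ind.
- move=> A; rewrite (brp_sigma_field X_right) => /(_ mu)[B [N [nB nN N0 AB]]].
  exists (fun w => (\1_B w)%:E), N; split=> //.
    by apply/measurable_EFinP; apply: measurable_indic.
  move=> w Nw; rewrite !indicE; congr (_%:R%:E); congr nat_of_bool.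
  apply/idP/idP; rewrite !inE => H; apply: contrapT => H'; apply/Nw/AB;
    by [left|right].
- move=> c f g c0 mf mg f0 g0 [f' [N [mf' f'0 nN N0 ff']]] [g' [M [mg' g'0 nM M0 gg']]].
  pose NM n := if n is 0%N then N else M.
  exists (fun w => (c%:E * f' w + g' w)%E), (\bigcup_n NM n); split.
  + by apply: emeasurable_funD => //; exact: measurable_funeM.
  + by move=> w; rewrite adde_ge0// mule_ge0.
  + by apply: sigma_algebra_bigcup => -[|n].
  + by apply: bigcup_null => -[|n].
  + move=> w NMw; rewrite ff' ?gg'// => Nw; apply: NMw.
      by exists 1%N.
    by exists 0%N.
- move=> f_ f mf f0 ndf cf IH.
  have /choice[ZN H] : forall n, exists ZN : (Omega -> \bar R) * set Omega,
      [/\ measurable_fun setT (ZN.1 : natural_space X -> \bar R),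
          forall w, (0 <= ZN.1 w)%E, natural_field_infty X ZN.2,
          (\int[mu]_x P x ZN.2 = 0)%E & forall w, ~ ZN.2 w -> f_ n w = ZN.1 w].
    by move=> n; have [Z' [N ?]] := IH n; exists (Z', N).
  (* On the exceptional set the versions need not be monotone or even converge. An upper limit is
     measurable in any case, and the absolute value gives nonnegativity at once; elsewhere both
     reduce to the limit [f]. *)
  exists (fun w => `|limn_esup (fun n => (ZN n).1 w)|%E), (\bigcup_n (ZN n).2); split.
  + apply: measurableT_comp => //; apply: measurable_fun_limn_esup => n.
    by have [] := H n.
  + by [].
  + by apply: sigma_algebra_bigcup => n; have [] := H n.
  + by apply: bigcup_null => n; have [] := H n.
  + move=> w Nw; rewrite (_ : (fun n => _) = f_ ^~ w); last first.
      apply/funext => n; have [_ _ _ _ ->//] := H n.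
      by move=> ZNw; apply: Nw; exists n.
    have cw : f_ ^~ w @ \oo --> f w by exact: cf.
    rewrite is_cvg_limn_esupE; last by apply/cvg_ex; exists (f w).
    rewrite (cvg_lim _ cw)// gee0_abs//.
    by rewrite -(cvg_lim _ cw)//; apply: lime_ge; [apply/cvg_ex; exists (f w)|exact: nearW].
Qed.

Section functional.
Variables (x : E) (t : R) (Y : Omega -> R).
Hypothesis t0 : 0 <= t.
Hypothesis Y_adapted :
  forall B : set R, measurable B -> augmented_filtration P X t (Y @^-1` B).

Let mY : measurable_fun setT Y.
Proof.
move=> _ B mB; rewrite setTI.
exact: augmented_filtration_measurable X_right _ _ (Y_adapted mB).
Qed.

Let mX : measurable_fun setT (X t : Omega -> borel E).
Proof. exact: measurable_process X_right _ t0. Qed.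

Let mtheta : measurable_fun setT (theta t : Omega -> natural_space X).
Proof. exact: measurable_shift. Qed.

(** The past event of the Markov property is enlarged to a function of [Y] by induction on [phi],
    with the future event [L] kept fixed. *)
Lemma markov_set_fun (L : set Omega) (phi : R -> \bar R) :
  natural_field_infty X L ->
  measurable_fun setT phi -> (forall r, (0 <= phi r)%E) ->
  (\int[P x]_w (phi (Y w) * (\1_L (theta t w))%:E) =
   \int[P x]_w (phi (Y w) * P (X t w) L))%E.
Proof.
move=> nL.
have m1 : measurable_fun setT (fun w => (\1_L (theta t w))%:E : \bar R).
  apply/measurable_EFinP.
  exact: measurableT_comp (@measurable_indic _ (natural_space X) R setT L nL) mtheta.
have m2 : measurable_fun setT (fun w => P (X t w) L).
  exact: (@measurableT_comp _ _ _ _ (borel E) _ _ _ _ (measurable_law X_right nL) mX).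
have fin2 w : P (X t w) L \is a fin_num.
  by apply: fin_num_measure; exact: natural_field_infty_measurable X_right _ nL.
move: phi; apply: ge0_measurable_ind.
- move=> B mB.
  have mYB : measurable (Y @^-1` B).
    exact: augmented_filtration_measurable X_right _ _ (Y_adapted mB).
  have mtL : measurable (theta t @^-1` L).
    by rewrite -[X in measurable X]setTI; exact: mtheta.
  transitivity (P x (Y @^-1` B `&` theta t @^-1` L)).
    rewrite -[X in P x X]setIT -integral_indic//; last exact: measurableI.
    by apply: eq_integral => w _; rewrite indicI EFinM.
  rewrite (markov_set X_right)//; last exact: Y_adapted.
  rewrite integral_mkcond; apply: eq_integral => w _.
  rewrite patchE indicE; have -> : (Y w \in B) = (w \in Y @^-1` B).
    by apply/idP/idP; rewrite !inE.
  by case: ifPn => _; rewrite ?mul1e ?mul0e.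
- move=> c f g c0 mf mg f0 g0 IHf IHg.
  have D (h : Omega -> \bar R) : measurable_fun setT h -> (forall w, 0 <= h w)%E ->
    (\int[P x]_w ((c%:E * f (Y w) + g (Y w)) * h w) =
     c%:E * \int[P x]_w (f (Y w) * h w) + \int[P x]_w (g (Y w) * h w))%E.
    move=> mh h0.
    have mfh : measurable_fun setT (fun w => f (Y w) * h w)%E.
      by apply: emeasurable_funM => //; exact: measurableT_comp.
    have mgh : measurable_fun setT (fun w => g (Y w) * h w)%E.
      by apply: emeasurable_funM => //; exact: measurableT_comp.
    rewrite -ge0_integralZl_EFin// => [|w _]; last by rewrite mule_ge0.
    rewrite -ge0_integralD//.
    + apply: eq_integral => w _; rewrite ge0_muleDl ?mule_ge0//.
      by rewrite muleA.
    + by move=> w _; rewrite !mule_ge0.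
    + exact: measurable_funeM.
    + by move=> w _; rewrite mule_ge0.
  by rewrite !D// ?IHf ?IHg// => w; rewrite lee_fin.
- move=> f_ f mf f0 ndf cf IH.
  have C (h : Omega -> \bar R) : measurable_fun setT h -> (forall w, 0 <= h w)%E ->
    (forall w, h w \is a fin_num) ->
    (\int[P x]_w (f (Y w) * h w) = limn (fun n => \int[P x]_w (f_ n (Y w) * h w)))%E.
    move=> mh h0 fh.
    rewrite -monotone_convergence//.
    + apply: eq_integral => w _; apply/esym/cvg_lim => //.
      by apply: cvgeZr => //; exact: cf.
    + by move=> n; apply: emeasurable_funM => //; exact: measurableT_comp.
    + by move=> n w _; rewrite mule_ge0.
    + by move=> w _ m n mn; rewrite lee_wpmul2r//; exact: ndf.
  by rewrite !C//; congr (limn _); apply/funext => n; exact: IH.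
Qed.

(** The induction is now on the future factor. [Z] is measurable for the uncompleted field, which
    makes its expectation a Borel function of the starting point. *)
Lemma markov_fun (Z : Omega -> \bar R) :
  (forall w, 0 <= Y w) ->
  measurable_fun setT (Z : natural_space X -> \bar R) -> (forall w, (0 <= Z w)%E) ->
  (\int[P x]_w ((Y w)%:E * Z (theta t w)) =
   \int[P x]_w ((Y w)%:E * \int[P (X t w)]_w' Z w'))%E.
Proof.
move=> Y0.
have mYE : measurable_fun setT (fun w => (Y w)%:E) by apply/measurable_EFinP.
have mint (f : natural_space X -> \bar R) : measurable_fun setT f ->
    (forall w, (0 <= f w)%E) ->
    measurable_fun setT (fun w => \int[P (X t w)]_w' f w')%E.
  move=> mf f0; apply: (@measurableT_comp _ _ _ _ (borel E) _
    (fun y => \int[P y]_w' f w')%E _ _ _ mX).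
  apply: (@measurable_fun_integral_comp _ _ _ _ (borel E) Omega (natural_space X)
    (fun y => P y : {measure set Omega -> \bar R}) id) => //.
    exact: measurable_natural_id.
  by move=> A mA; exact: measurable_law X_right _ mA.
move: Z; apply: (@ge0_measurable_ind _ _ (natural_space X)).
- move=> L nL.
  (* The positive part is nonnegative on the whole line, as the previous lemma requires, and is the
     identity on the values of [Y]. *)
  pose phi (r : R) := (Num.max r 0)%:E.
  have phiY w : phi (Y w) = (Y w)%:E by rewrite /phi max_l.
  have := @markov_set_fun L phi nL.
  under eq_integral do rewrite phiY.
  move=> -> //.
  + apply: eq_integral => w _; rewrite phiY; congr (_ * _)%E.
    by rewrite integral_indic// ?setIT//; exact: natural_field_infty_measurable X_right _ nL.
  + apply/measurable_EFinP; exact: (@measurable_maxr _ _ R setT id (cst 0)).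
  + by move=> r; rewrite lee_fin le_max lexx orbT.
- move=> c f g c0 mf mg f0 g0 IHf IHg.
  have mf' := measurable_natural_fun mf; have mg' := measurable_natural_fun mg.
  have mft := measurableT_comp mf mtheta; have mgt := measurableT_comp mg mtheta.
  have D (h k : Omega -> \bar R) : measurable_fun setT h -> measurable_fun setT k ->
    (forall w, 0 <= h w)%E -> (forall w, 0 <= k w)%E ->
    (\int[P x]_w ((Y w)%:E * (c%:E * h w + k w)) =
     c%:E * \int[P x]_w ((Y w)%:E * h w) + \int[P x]_w ((Y w)%:E * k w))%E.
    move=> mh mk h0 k0.
    have mYh : measurable_fun setT (fun w => (Y w)%:E * h w)%E.
      exact: emeasurable_funM.
    have mYk : measurable_fun setT (fun w => (Y w)%:E * k w)%E.
      exact: emeasurable_funM.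
    rewrite -ge0_integralZl_EFin// => [|w _]; last by rewrite mule_ge0// lee_fin.
    rewrite -ge0_integralD//.
    + apply: eq_integral => w _; rewrite ge0_muleDr ?mule_ge0//.
      by rewrite muleCA.
    + by move=> w _; rewrite !mule_ge0// lee_fin.
    + exact: measurable_funeM.
    + by move=> w _; rewrite mule_ge0// lee_fin.
  rewrite D// IHf IHg -D//.
  + apply: eq_integral => w _; congr (_ * _)%E.
    rewrite ge0_integralD//; last 2 first.
    * by move=> w' _; rewrite mule_ge0.
    * exact: measurable_funeM.
    by rewrite ge0_integralZl_EFin.
  + exact: mint.
  + exact: mint.
  + by move=> w; exact: integral_ge0.
  + by move=> w; exact: integral_ge0.
- move=> f_ f mf f0 ndf cf IH.
  have mf' n := measurable_natural_fun (mf n).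
  have C (h_ : (Omega -> \bar R)^nat) (h : Omega -> \bar R) :
    (forall n, measurable_fun setT (h_ n)) -> (forall n w, 0 <= h_ n w)%E ->
    (forall w, nondecreasing_seq (h_ ^~ w)) -> (forall w, h_ ^~ w @ \oo --> h w) ->
    (\int[P x]_w ((Y w)%:E * h w) = limn (fun n => \int[P x]_w ((Y w)%:E * h_ n w)))%E.
    move=> mh h0 ndh ch.
    rewrite -monotone_convergence//.
    + apply: eq_integral => w _; apply/esym/cvg_lim => //.
      by apply: cvgeZl => //; exact: ch.
    + by move=> n; exact: emeasurable_funM.
    + by move=> n w _; rewrite mule_ge0// lee_fin.
    + by move=> w _ m n mn; rewrite lee_wpmul2l ?lee_fin//; exact: ndh.
  rewrite (C (fun n w => f_ n (theta t w)))//; last first.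
    by move=> n; exact: measurableT_comp (mf n) mtheta.
  rewrite (C (fun n w => \int[P (X t w)]_w' f_ n w'))%E//.
  + by congr (limn _); apply/funext => n; exact: IH.
  + by move=> n; exact: mint.
  + by move=> n w; exact: integral_ge0.
  + by move=> w m n mn; apply: ge0_le_integral => // w' _; exact: ndf.
  + move=> w.
    have -> : (\int[P (X t w)]_w' f w' = \int[P (X t w)]_w' limn (f_ ^~ w'))%E.
      by apply: eq_integral => w' _; apply/esym/cvg_lim => //; exact: cf.
    by apply: cvg_monotone_convergence => // w' _; exact: ndf.
Qed.

End functional.
End markov_property.

(** * Pricing operators *)

Section pricing_semigroup.
Context {R : realType} {E : ptopologicalType} d {Omega : measurableType d}.
Variables (P : E -> probability Omega R) (X : R -> Omega -> E).
Variables (theta : R -> Omega -> Omega) (S : R -> Omega -> R).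
Hypothesis X_right : borel_right_process P X theta.
Hypothesis S_kernel : pricing_kernel P X theta S.

Lemma pricing_kernel_adapted (t : R) (B : set R) : 0 <= t -> measurable B ->
  augmented_filtration P X t (S t @^-1` B).
Proof.
by move=> t0 mB; have [+ _] := pk_semimartingale S_kernel point; exact.
Qed.

Lemma measurable_pricing_kernel (t : R) : 0 <= t -> measurable_fun setT (S t).
Proof.
move=> t0 _ B mB; rewrite setTI.
exact: augmented_filtration_measurable X_right _ _ (pricing_kernel_adapted t0 mB).
Qed.

Lemma measurable_pricing_kernelM (t : R) (k : borel E -> R) : 0 <= t ->
  measurable_fun setT k -> measurable_fun setT (fun w => S t w * k (X t w)).
Proof.
move=> t0 mk; apply: measurable_funM; first exact: measurable_pricing_kernel.
exact: measurableT_comp mk (measurable_process X_right t0).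
Qed.

Lemma pricing_operatorE (t : R) (k : E -> R) (x : E) :
  pricing_operator P X S t k x = (\int[P x]_w (S t w * k (X t w))%:E)%E.
Proof. by rewrite /pricing_operator unlock. Qed.

(* The semigroup property, with a Borel version [F] of [P_s k]. *)
Lemma pricing_semigroup_version (mu : probability (borel E) R) (s : R)
    (k : borel E -> R) :
  0 <= s -> measurable_fun setT k -> (forall y, 0 <= k y) ->
  exists (F : borel E -> \bar R) (D : set (borel E)),
    [/\ measurable_fun setT F, forall y, (0 <= F y)%E, measurable D /\ mu D = 0%E,
        forall y, ~ D y -> pricing_operator P X S s k y = F y &
        forall x t, 0 <= t -> P x (X t @^-1` D) = 0%E ->
          pricing_operator P X S (t + s) k x =
          (\int[P x]_w ((S t w)%:E * F (X t w)))%E].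
Proof.
move=> s0 mk k0.
pose Z w := (S s w * k (X s w))%:E.
have mZ : measurable_fun setT Z by apply/measurable_EFinP; exact: measurable_pricing_kernelM.
have Z0 w : (0 <= Z w)%E.
  by rewrite lee_fin mulr_ge0// ltW// (pk_gt0 S_kernel).
have [Z' [N [mZ' Z'0 nN N0 ZZ']]] := natural_version X_right mu mZ Z0.
have mlN := measurable_law X_right nN.
have mN := natural_field_infty_measurable X_right nN.
have mZ'O := measurable_natural_fun X_right mZ'.
(* [D] collects the starting points that charge the exceptional event [N]. Off [D] the natural
   version computes P_s k exactly, and [mu D = 0] because P_mu(N) = 0. *)
pose D : set (borel E) := [set y | P y N != 0%E].
have mD : measurable D.
  rewrite -[D]setTI; apply: emeasurable_neq => //.
exists (fun y => \int[P y]_w Z' w)%E, D; split.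
- apply: (@measurable_fun_integral_comp _ _ _ _ (borel E) Omega (natural_space X)
    (fun y => P y : {measure set Omega -> \bar R}) id) => //.
    exact: measurable_natural_id X_right.
  by move=> A mA; exact: measurable_law X_right _ mA.
- by move=> y; exact: integral_ge0.
- split=> //.
  have [] := @ae_eq_integral_abs _ (borel E) _ mu setT measurableT _ mlN.
  have -> : (\int[mu]_x `|P x N| = \int[mu]_x P x N)%E.
    by apply: eq_integral => y _; rewrite gee0_abs.
  move=> /(_ N0) [M [mM M0 DM]] _.
  apply: (@subset_measure0 _ _ _ mu D M) => // y Dy; apply: DM => /= H.
  by move: Dy; rewrite /D /= H// eqxx.
- move=> y /negP; rewrite negbK => /eqP yN; rewrite pricing_operatorE.
  exact: (ge0_integral_eq_off_null mN yN mZ mZ'O Z0 Z'0 ZZ').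
- move=> x t t0 Dx0.
  have ts0 : 0 <= t + s by rewrite addr_ge0.
  have mtheta := measurable_shift X_right t0.
  have mX := measurable_process X_right t0.
  have St0 w : 0 <= S t w by rewrite ltW// (pk_gt0 S_kernel).
  have mthetaN : measurable (theta t @^-1` N).
    by rewrite -[X in measurable X]setTI; exact: mtheta.
  (* A path whose position at time [t] avoids [D] almost surely continues outside [N]. *)
  have Nx0 : P x (theta t @^-1` N) = 0%E.
    rewrite -[X in P x X]setTI (markov_set X_right x t0)//; last first.
      by apply: sub_augmentation; rewrite -setC0; apply: sigma_algebraC; exact: sigma_algebra0.
    rewrite -[RHS](integral0 (P x) setT).
    apply: (@ge0_integral_eq_off_null _ _ _ (P x) (X t @^-1` D)) => //.
    + by rewrite -[X in measurable X]setTI; exact: mX.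
    + exact: (@measurableT_comp _ _ _ _ (borel E) _ _ _ _ mlN mX).
    + by move=> w /negP; rewrite negbK => /eqP.
  rewrite -(markov_fun X_right x t0)//; last by move=> B mB; exact: pricing_kernel_adapted.
  rewrite pricing_operatorE.
  apply: (@ge0_integral_eq_off_null _ _ _ (P x) (theta t @^-1` N)) => //.
  + by apply/measurable_EFinP; exact: measurable_pricing_kernelM.
  + apply: emeasurable_funM; first by apply/measurable_EFinP; exact: measurable_pricing_kernel.
    exact: measurableT_comp mZ' mtheta.
  + by move=> w; rewrite lee_fin mulr_ge0// ltW// (pk_gt0 S_kernel).
  + by move=> w; rewrite mule_ge0// lee_fin.
  + move=> w /ZZ' <-; rewrite (pk_multiplicative S_kernel)// /Z.
    by rewrite (brp_shift X_right)// -EFinM mulrA (addrC s t).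
Qed.

(** Both terms of the semimartingale decomposition are almost surely cadlag. The exceptional set
    depends on [x]. *)
Lemma pricing_kernel_right_continuous (x : E) :
  exists N : set Omega, [/\ measurable N, P x N = 0%E &
    forall w, ~ N w -> forall t : R, 0 <= t -> S s w @[s --> t^'+] --> S t w].
Proof.
have [_ [M [A [[_ [N1 [mN1 N10 cM]] _] [_ [N2 [mN2 N20 cA]]] [N3 [mN3 N30 SMA]]]]]] :=
  pk_semimartingale S_kernel x.
exists (N1 `|` N2 `|` N3); split.
- by do 2!apply: measurableU => //.
- apply: null_set_setU => //; first exact: measurableU.
  exact: null_set_setU.
move=> w Nw t t0.
have [cMw _] : cadlag (fun t => M t w).
  by apply: contrapT => H; apply: Nw; left; left; exact: cM.
have [[cAw _] _] : cadlag (fun t => A t w) /\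
    forall t : R, 0 <= t -> bounded_variation 0 t (fun s => A s w).
  by apply: contrapT => H; apply: Nw; left; right; exact: cA.
have [_ _ Sw] : [/\ M 0 w = 0, A 0 w = 0 &
      forall t : R, 0 <= t -> S t w = S 0 w + M t w + A t w].
  by apply: contrapT => H; apply: Nw; right; exact: SMA.
rewrite Sw//.
have : (S 0 w + M s w + A s w) @[s --> t^'+] --> S 0 w + M t w + A t w.
  by apply: cvgD; [apply: cvgD; [exact: cvg_cst|exact: cMw]|exact: cAw].
apply: cvg_trans; apply: near_eq_cvg.
near=> s; rewrite (Sw s)//.
by apply: (le_trans t0); apply: ltW; near: s; exact: nbhs_right_gt.
Unshelve. all: by end_near. Qed.

End pricing_semigroup.

Lemma measurable_fun_invr_gt0 {R : realType} d (T : measurableType d) (f : T -> R) :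
  measurable_fun setT f -> (forall y, 0 < f y) ->
  measurable_fun setT (fun y => (f y)^-1).
Proof.
move=> mf f0; apply: (eq_measurable_fun (fun y => f y `^ (-1))).
  by move=> y _; rewrite powR_inv1// ltW.
exact: measurableT_comp (measurable_powR _) mf.
Qed.

(** * Measurability in time and laws at almost every time *)

Section time_measurability.
Context {R : realType} {E : ptopologicalType} d {Omega : measurableType d}.
Variables (P : E -> probability Omega R) (X : R -> Omega -> E).
Variables (theta : R -> Omega -> Omega) (S : R -> Omega -> R).
Hypothesis E_lusin : lusin_space R E.
Hypothesis X_right : borel_right_process P X theta.
Hypothesis S_kernel : pricing_kernel P X theta S.

Lemma measurable_process_pair :
  measurable_fun setT ((fun z : R * Omega => X (Num.max z.1 0) z.2) : _ -> borel E).
Proof.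
apply: measurable_fun_right_continuous_lusin => //.
- by move=> t t0; exact (measurable_process X_right t0).
- exact: brp_right_continuous_paths X_right.
Qed.

(** [nu] is the law of [X] at an independent standard normal time, clamped at 0. By Fubini a
    [nu]-null set is missed at Gaussian-almost every time. *)
Lemma occupation_law (x : E) : exists nu : probability (borel E) R,
  forall D : set (borel E), measurable D -> nu D = 0%E ->
  exists T : set R, [/\ measurable T, lebesgue_measure T = 0%E &
    forall t, 0 <= t -> ~ T t -> P x (X t @^-1` D) = 0%E].
Proof.
pose Xp : measurableTypeR R * Omega -> borel E := fun z => X (Num.max z.1 0) z.2.
have mXp : measurable_fun setT Xp := measurable_process_pair.
pose Xm : {mfun _ >-> _} := HB.pack Xp (isMeasurableFun.Build _ _ _ _ _ mXp).
pose gauss : probability (measurableTypeR R) R := normal_prob 0 1.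
exists (distribution (gauss \x P x)%E Xm) => D mD.
have mA : measurable (Xp @^-1` D) by rewrite -[X in measurable X]setTI; exact: (mXp).
have sec t : 0 <= t -> xsection (Xp @^-1` D) t = X t @^-1` D.
  by move=> t0; apply/seteqP; split=> w; rewrite /xsection /Xp /= inE /= max_l.
rewrite /distribution /pushforward /= => nuD0.
have ms : measurable_fun setT (P x \o xsection (Xp @^-1` D)).
  exact: measurable_fun_xsection.
pose T : set (measurableTypeR R) := [set t | P x (xsection (Xp @^-1` D) t) != 0%E].
have mT : measurable T.
  by rewrite -[T]setTI; apply: emeasurable_neq.
have gT : gauss T = 0%E.
  have [] := @ae_eq_integral_abs _ _ _ gauss setT measurableT _ ms.
  have -> : (\int[gauss]_t `|(P x \o xsection (Xp @^-1` D)) t| = 0)%E.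
    by rewrite -[RHS]nuD0; apply: eq_integral => t _; rewrite gee0_abs.
  move=> /(_ erefl) [M [mM M0 TM]] _.
  apply: (@subset_measure0 _ _ _ gauss T M) => // t Tt; apply: TM => /= H.
  by move: Tt; rewrite /T /= H// eqxx.
exists T; split=> //.
  have mpdf : measurable_fun T (fun t : measurableTypeR R => (normal_pdf 0 1 t)%:E : \bar R).
    by apply/measurable_EFinP; apply: measurable_funTS; exact: measurable_normal_pdf.
  (* The normal density is strictly positive, so a Gaussian-null set of times is Lebesgue-null. *)
  have [] := @ae_eq_integral_abs _ _ _ (@lebesgue_measure R) T mT _ mpdf.
  have -> : (\int[@lebesgue_measure R]_(t in T) `|(normal_pdf 0 1 t)%:E| = 0)%E.
    rewrite -[RHS]gT; apply: eq_integral => t _.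
    by rewrite gee0_abs// lee_fin normal_pdf_ge0.
  move=> /(_ erefl) [M [mM M0 TM]] _.
  apply: (@subset_measure0 _ _ _ (@lebesgue_measure R) T M) => // t Tt; apply: TM => /= H.
  have /eqP := H Tt; rewrite eqe normal_pdfE ?oner_eq0// mulf_eq0.
  by rewrite !gt_eqF ?normal_peak_gt0 ?oner_eq0 ?expR_gt0.
by move=> t t0 /negP; rewrite negbK sec// => /eqP.
Qed.

(** Replacing S by 0 on the null set of its bad paths makes every path right-continuous, hence the
    integrand jointly measurable; Fubini then applies. *)
Lemma measurable_pricing_operator (x : E) (k : borel E -> R) :
  measurable_fun setT k -> (forall y, 0 <= k y) ->
  measurable_fun [set t : R | 0 <= t] (fun t => pricing_operator P X S t k x).
Proof.
move=> mk k0.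
have [N [mN N0 cS]] := pricing_kernel_right_continuous S_kernel x.
pose S' t w := (S t \_ (~` N)) w.
have mS' t : 0 <= t -> measurable_fun setT (S' t).
  move=> t0; apply/(@measurable_restrict _ _ _ _ (~` N) setT) => //.
    exact: measurableC.
  by apply: measurable_funTS; exact (measurable_pricing_kernel X_right S_kernel t0).
have S'0 t w : 0 <= t -> 0 <= S' t w.
  by move=> t0; rewrite /S' patchE; case: ifP => // _; rewrite ltW// (pk_gt0 S_kernel).
have mSp : measurable_fun setT (fun z : R * Omega => S' (Num.max z.1 0) z.2).
  apply/measurable_EFinP.
  apply: (@measurable_fun_right_continuous _ _ _ (fun t w => (S' t w)%:E)).
    by move=> t t0; apply/measurable_EFinP; exact: mS'.
  move=> w t t0; apply: cvg_EFin; first by apply: nearW.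
  rewrite (_ : fine \o _ = (fun s => S' s w))//.
  rewrite /S'; under eq_fun do rewrite patchE.
  rewrite patchE; case: ifPn => [|_]; last exact: cvg_cst.
  by rewrite inE => Nw; exact: cS.
have t0 (t : R) : 0 <= Num.max t 0 by rewrite le_max lexx orbT.
pose G (z : R * Omega) := (S' (Num.max z.1 0) z.2 * k (X (Num.max z.1 0) z.2))%:E.
have mG : measurable_fun setT G.
  apply/measurable_EFinP; apply: measurable_funM => //.
  exact: measurableT_comp mk measurable_process_pair.
have G0 z : (0 <= G z)%E by rewrite lee_fin mulr_ge0// S'0.
have := @measurable_fun_fubini_tonelli_F _ _ _ _ _ (P x) G mG G0.
move=> /(measurable_funS measurableT (@subsetT _ [set t : R | 0 <= t])).
apply: eq_measurable_fun => t; rewrite inE /= => tge0.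
rewrite pricing_operatorE /fubini_F /G /= max_l//.
apply: (ge0_integral_eq_off_null mN N0).
- apply/measurable_EFinP; apply: measurable_funM; first exact: mS'.
  exact: measurableT_comp mk (measurable_process X_right tge0).
- by apply/measurable_EFinP; exact (measurable_pricing_kernelM X_right S_kernel tge0 mk).
- by move=> w; rewrite lee_fin mulr_ge0// S'0.
- by move=> w; rewrite lee_fin mulr_ge0// ltW// (pk_gt0 S_kernel).
- by move=> w Nw; rewrite /S' patchE ifT// inE.
Qed.

Lemma start_set_measurable (x : E) :
  measurable [set w | X 0 w = x] /\ P x (~` [set w | X 0 w = x]) = 0%E.
Proof.
have m1 : measurable [set w | X 0 w = x].
  have := measurable_process X_right (lexx 0) measurableT (lusin_measurable1 x E_lusin).
  by rewrite setTI.
split=> //; rewrite probability_setC// (brp_start X_right).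
by rewrite subee.
Qed.

(** Almost surely [X 0 = x], so [pi (X 0)] leaves the integral as the constant [pi x]. That this
    event is measurable rests on points of a Lusin space being Borel. *)
Lemma eigen_transitionE (pi : borel E -> R) (lambda t : R) (x : E) (B : set (borel E)) :
  measurable_fun setT pi -> (forall y, 0 < pi y) -> measurable B -> 0 <= t ->
  eigen_transition P X S pi lambda t x B =
  ((expR (lambda * t) / pi x)%:E *
    pricing_operator P X S t (fun y => pi y * \1_B y)%R x)%E.
Proof.
move=> mpi pi0 mB t0; have [m1 N0] := start_set_measurable x.
have mX := measurable_process X_right t0.
have mX0 := measurable_process X_right (lexx 0).
have mSt := measurable_pricing_kernel X_right S_kernel t0.
have mpi1 : measurable_fun setT (fun y : borel E => pi y * \1_B y).
  by apply: measurable_funM => //; exact: measurable_indic.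
have mXB : measurable (X t @^-1` B) by rewrite -[X in measurable X]setTI; exact: mX.
have pi1_ge0 y : 0 <= pi y * \1_B y by rewrite mulr_ge0// ltW.
have c0 : 0 <= expR (lambda * t) / pi x by rewrite divr_ge0 ?expR_ge0// ltW.
rewrite pricing_operatorE /eigen_transition /eigen_law integral_mkcond.
rewrite -ge0_integralZl_EFin//; last 2 first.
- by move=> w _; rewrite lee_fin mulr_ge0// ltW// (pk_gt0 S_kernel).
- by apply/measurable_EFinP; exact (measurable_pricing_kernelM X_right S_kernel t0 mpi1).
apply: (ge0_integral_eq_off_null (measurableC m1) N0).
- apply/(@measurable_restrict _ _ _ _ (X t @^-1` B) setT) => //.
  apply: measurable_funTS; apply/measurable_EFinP.
  apply: measurable_funM => //; apply: measurable_funM => //.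
  apply: measurable_funM.
    exact: measurableT_comp mpi mX.
  by apply: measurable_fun_invr_gt0 => //; exact: measurableT_comp mpi mX0.
- apply: measurable_funeM; apply/measurable_EFinP.
  exact (measurable_pricing_kernelM X_right S_kernel t0 mpi1).
- move=> w; apply: erestrict_ge0 => {}w _; rewrite lee_fin /eigen_martingale.
  by rewrite !mulr_ge0 ?expR_ge0 ?invr_ge0 ?ltW// (pk_gt0 S_kernel).
- by move=> w; rewrite -EFinM lee_fin mulr_ge0// mulr_ge0// ltW// (pk_gt0 S_kernel).
- move=> w /= /contrapT Xw; rewrite patchE /eigen_martingale Xw -EFinM.
  rewrite indicE; have -> : (X t w \in B) = (w \in X t @^-1` B).
    by apply/idP/idP; rewrite !inE.
  case: ifPn => _; last by rewrite !mulr0.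
  by congr EFin; rewrite mulr1; ring.
Qed.

End time_measurability.

(** * Telescoping bounds for integrals over time *)

(** The shifted terms complete the first [p] terms to a sum of [p + m] terms, which dominates the
    first [m]. The bound does not depend on [m]. *)
Lemma sum_shift_diff_le {R : realType} (v : nat -> R) (p m : nat) :
  (forall i, 0 <= v i) ->
  \sum_(i < m) (v i - v (i + p)%N) <= \sum_(i < p) v i.
Proof.
move=> v0; rewrite sumrB lerBlDr.
have -> : \sum_(i < p) v i + \sum_(i < m) v (i + p)%N = \sum_(i < p + m) v i.
  rewrite big_split_ord /=; congr (_ + _); apply: eq_bigr => i _.
  by rewrite addnC.
rewrite addnC big_split_ord /= lerDl; exact: sumr_ge0.
Qed.

Lemma integral_le_unit_steps {R : realType} (q : R -> \bar R) (T : set R)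
    (c : nat -> R) (M : R) :
  measurable_fun [set t : R | 0 <= t] q -> (forall t, 0 <= t -> (0 <= q t)%E) ->
  measurable T -> lebesgue_measure T = 0%E ->
  (forall i t, i%:R <= t -> t < i.+1%:R -> ~ T t -> (q t <= (c i)%:E)%E) ->
  (forall i, 0 <= c i) -> (forall m, \sum_(i < m) c i <= M) ->
  (\int[lebesgue_measure]_(t in [set t : R | (0 <= t)%R]) q t <= M%:E)%E.
Proof.
move=> mq q0 mT T0 qc c0 cM.
pose I (i : nat) : set R := `[i%:R, i.+1%:R[%classic.
have pos : [set t : R | 0 <= t] = \bigcup_i I i.
  apply/seteqP; split=> t /=.
    by move=> t0; exists (Num.truncn t) => //=; rewrite /I/= in_itv/= truncn_itv.
  by move=> [i _]; rewrite /I/= in_itv/= => /andP[it _]; exact: le_trans it.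
rewrite pos in mq *.
have mI i : measurable (I i) by exact: measurable_itv.
have q0' t : (\bigcup_i I i) t -> (0 <= q t)%E.
  by rewrite -pos; exact: q0.
rewrite ge0_integral_bigcup//; last first.
  apply/trivIsetP => i j _ _; rewrite neq_lt => /orP[] ij;
    apply/seteqP; split=> t //= []; rewrite /I/= !in_itv/= => /andP[a b] /andP[c' e].
    have : j%:R < i.+1%:R :> R := le_lt_trans c' b.
    by rewrite ltr_nat ltnS leqNgt (ij : (i < j)%N).
  have : i%:R < j.+1%:R :> R := le_lt_trans a e.
  by rewrite ltr_nat ltnS leqNgt (ij : (j < i)%N).
have I1 i : lebesgue_measure (I i) = 1%E.
  rewrite /I lebesgue_measure_itv/= lte_fin ltr_nat ltnSn.
  by rewrite -EFinD -natrB// subSnn.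
have step i : (\int[lebesgue_measure]_(t in I i) q t <= (c i)%:E)%E.
  have -> : (c i)%:E = (\int[lebesgue_measure]_(t in I i) (c i)%:E)%E.
    rewrite integral_cst; last exact: measurable_itv.
    by rewrite -[LHS]mule1; congr (_ * _)%E; exact/esym/I1.
  have mqi : measurable_fun (I i) q.
    by move: i; apply/measurable_fun_bigcup.
  apply: ae_ge0_le_integral.
  - exact: mI.
  - by move=> t it; apply: q0'; exists i.
  - exact: mqi.
  - by move=> t _; rewrite lee_fin.
  - exact: measurable_cst.
  - exists T; split=> // t /=; apply: contra_notP => Tt; rewrite /I/= in_itv/=.
    by move=> /andP[it ti]; exact: qc it ti Tt.
apply: lime_le.
  by apply: is_cvg_nneseries => i _ _; apply: integral_ge0 => t it; apply: q0'; exists i.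
apply: nearW => m; apply: (@le_trans _ _ (\sum_(0 <= i < m) (c i)%:E)%E).
  by apply: lee_sum => i _; exact: step.
by rewrite sumEFin lee_fin big_mkord.
Qed.

(** * Strict concavity across rays *)

Section tangent.
Context {R : realFieldType}.
Implicit Types a b u v : R.

(* The concave, 1-homogeneous function (u, v) |-> uv/(u+v) lies below its
   tangent plane at (a, b), and touches it only on the ray through (a, b). *)
Lemma harmonic_tangentE a b u v : 0 < a -> 0 < b -> 0 < u -> 0 < v ->
  (b / (a + b)) ^+ 2 * u + (a / (a + b)) ^+ 2 * v - u * v / (u + v) =
  (b * u - a * v) ^+ 2 / ((a + b) ^+ 2 * (u + v)).
Proof.
move=> a0 b0 u0 v0.
have ab : a + b != 0 by rewrite gt_eqF// addr_gt0.
have uv : u + v != 0 by rewrite gt_eqF// addr_gt0.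
by field; rewrite ab uv.
Qed.

End tangent.

(** * Order, null sets and recurrence through the pricing operators *)

Section pricing_operator.
Context {R : realType} {E : ptopologicalType} d {Omega : measurableType d}.
Variables (P : E -> probability Omega R) (X : R -> Omega -> E).
Variables (theta : R -> Omega -> Omega) (S : R -> Omega -> R).
Hypothesis E_lusin : lusin_space R E.
Hypothesis X_right : borel_right_process P X theta.
Hypothesis S_kernel : pricing_kernel P X theta S.

Local Notation A := (pricing_operator P X S).

Lemma pricing_operator_ge0 (t : R) (k : E -> R) x :
  0 <= t -> (forall y, 0 <= k y) -> (0 <= A t k x)%E.
Proof.
move=> t0 k0; rewrite pricing_operatorE; apply: integral_ge0 => w _.
by rewrite lee_fin mulr_ge0// ltW// (pk_gt0 S_kernel).
Qed.

Lemma pricing_operator_le (t : R) (k l : borel E -> R) x : 0 <= t ->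
  measurable_fun setT k -> measurable_fun setT l ->
  (forall y, 0 <= k y) -> (forall y, k y <= l y) -> (A t k x <= A t l x)%E.
Proof.
move=> t0 mk ml k0 kl; rewrite !pricing_operatorE; apply: ge0_le_integral => //.
- by move=> w _; rewrite lee_fin mulr_ge0// ltW// (pk_gt0 S_kernel).
- by apply/measurable_EFinP; exact (measurable_pricing_kernelM X_right S_kernel t0 mk).
- by apply/measurable_EFinP; exact (measurable_pricing_kernelM X_right S_kernel t0 ml).
- by move=> w _; rewrite lee_fin ler_wpM2l// ltW// (pk_gt0 S_kernel).
Qed.

Lemma pricing_operator_comb (t a b : R) (k l : borel E -> R) x : 0 <= t ->
  measurable_fun setT k -> measurable_fun setT l ->
  (forall y, 0 <= k y) -> (forall y, 0 <= l y) -> 0 <= a -> 0 <= b ->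
  A t (fun y => a * k y + b * l y) x = (a%:E * A t k x + b%:E * A t l x)%E.
Proof.
move=> t0 mk ml k0 l0 a0 b0; rewrite !pricing_operatorE.
have S0 w : 0 <= S t w by rewrite ltW// (pk_gt0 S_kernel).
have mSk : measurable_fun setT (fun w => (S t w * k (X t w))%:E).
  by apply/measurable_EFinP; exact (measurable_pricing_kernelM X_right S_kernel t0 mk).
have mSl : measurable_fun setT (fun w => (S t w * l (X t w))%:E).
  by apply/measurable_EFinP; exact (measurable_pricing_kernelM X_right S_kernel t0 ml).
rewrite -ge0_integralZl_EFin//; last by move=> w _; rewrite lee_fin mulr_ge0.
rewrite -ge0_integralZl_EFin//; last by move=> w _; rewrite lee_fin mulr_ge0.
rewrite -ge0_integralD//.
- by apply: eq_integral => w _; rewrite -!EFinM -EFinD; congr EFin; ring.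
- by move=> w _; rewrite -EFinM lee_fin !mulr_ge0.
- exact: measurable_funeM.
- by move=> w _; rewrite -EFinM lee_fin !mulr_ge0.
- exact: measurable_funeM.
Qed.

(** Since S is strictly positive, the nonnegative integrand has zero integral exactly when [k (X t)]
    vanishes almost surely. *)
Lemma pricing_operator_eq0 (t : R) (k : borel E -> R) x : 0 <= t ->
  measurable_fun setT k -> (forall y, 0 <= k y) ->
  A t k x = 0%E <-> P x (X t @^-1` [set y | k y != 0]) = 0%E.
Proof.
move=> t0 mk k0; rewrite pricing_operatorE.
have S0 w : 0 < S t w by rewrite (pk_gt0 S_kernel).
have mSk : measurable_fun setT (fun w => (S t w * k (X t w))%:E).
  by apply/measurable_EFinP; exact (measurable_pricing_kernelM X_right S_kernel t0 mk).
have mk0 : @measurable _ (borel E) [set y | k y != 0].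
  have -> : [set y | k y != 0] = ~` (k @^-1` [set 0]).
    by apply/seteqP; split=> y /= /eqP.
  by apply: measurableC; rewrite -[X in measurable X]setTI; exact: mk.
have mXk : measurable (X t @^-1` [set y | k y != 0]).
  by rewrite -[X in measurable X]setTI; exact: (measurable_process X_right t0).
have [I1 I2] := ae_eq_integral_abs (P x) measurableT mSk.
have I : (\int[P x]_w `|(S t w * k (X t w))%:E| = \int[P x]_w (S t w * k (X t w))%:E)%E.
  by apply: eq_integral => w _; rewrite gee0_abs// lee_fin mulr_ge0// ltW.
split=> [H|H].
  have [|M [mM M0 HM]] := I1; first by rewrite I.
  apply: (@subset_measure0 _ _ _ (P x) _ M) => // w kw; apply: HM => /= /(_ Logic.I) /eqP.
  by rewrite eqe mulf_eq0 gt_eqF//=; apply/negP.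
rewrite -I; apply: I2; exists (X t @^-1` [set y | k y != 0]); split=> // w /=.
by apply: contra_notP => /negP; rewrite negbK => /eqP -> _; rewrite mulr0.
Qed.

Lemma eigen_transition_eq0 (pi : borel E -> R) (lambda t : R) x (B : set (borel E)) :
  measurable_fun setT pi -> (forall y, 0 < pi y) -> measurable B -> 0 <= t ->
  eigen_transition P X S pi lambda t x B = 0%E <-> P x (X t @^-1` B) = 0%E.
Proof.
move=> mpi pi0 mB t0; rewrite (eigen_transitionE E_lusin X_right S_kernel)//.
have mpi1 : measurable_fun setT (fun y : borel E => pi y * \1_B y).
  by apply: measurable_funM => //; exact: measurable_indic.
have := @pricing_operator_eq0 t (fun y => pi y * \1_B y) x t0 mpi1.
have -> : [set y | pi y * \1_B y != 0] = B.
  apply/seteqP; split=> y /=; rewrite mulf_eq0 gt_eqF//= indicE.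
    by case: (boolP (y \in B)); rewrite ?eqxx// inE.
  by move=> By; rewrite mem_set// oner_eq0.
move=> H; rewrite -H => [|y]; last by rewrite mulr_ge0// ltW.
split=> [/eqP|->]; last by rewrite mule0.
by rewrite mule_eq0 eqe gt_eqF ?divr_gt0 ?expR_gt0//= => /eqP.
Qed.

Lemma measurable_eigen_transition (pi : borel E -> R) (lambda : R) x (B : set (borel E)) :
  measurable_fun setT pi -> (forall y, 0 < pi y) -> measurable B ->
  measurable_fun [set t : R | 0 <= t] (fun t => eigen_transition P X S pi lambda t x B).
Proof.
move=> mpi pi0 mB.
have mpi1 : measurable_fun setT (fun y : borel E => pi y * \1_B y).
  by apply: measurable_funM => //; exact: measurable_indic.
apply: (eq_measurable_fun (fun t => (expR (lambda * t) / pi x)%:E *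
    A t (fun y => (pi y * \1_B y)%R) x)%E).
  by move=> t; rewrite inE /= => t0; rewrite (eigen_transitionE E_lusin X_right S_kernel).
apply: emeasurable_funM.
  apply: measurable_funTS; apply/measurable_EFinP; apply: measurable_funM => //.
  by apply: measurableT_comp => //; exact: mulrl_measurable.
apply: (measurable_pricing_operator E_lusin X_right S_kernel) => // y.
by rewrite mulr_ge0// ltW.
Qed.

Lemma potential_eq0_ae (pi : borel E -> R) (lambda : R) x (B : set (borel E)) :
  measurable_fun setT pi -> (forall y, 0 < pi y) -> measurable B ->
  potential (eigen_transition P X S pi lambda) x B = 0%E ->
  exists T : set R, [/\ measurable T, lebesgue_measure T = 0%E &
    forall t, 0 <= t -> ~ T t -> P x (X t @^-1` B) = 0%E].
Proof.
move=> mpi pi0 mB.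
have mpos : measurable [set t : R | 0 <= t] by rewrite -set_itvcy; exact: measurable_itv.
have [I1 _] := ae_eq_integral_abs (@lebesgue_measure R) mpos
  (measurable_eigen_transition lambda x mpi pi0 mB).
have Q0 t : (0 <= t)%R -> (0 <= eigen_transition P X S pi lambda t x B)%E.
  move=> t0; apply: integral_ge0 => w _; rewrite lee_fin /eigen_martingale.
  by rewrite !mulr_ge0 ?expR_ge0 ?invr_ge0 ?ltW// (pk_gt0 S_kernel).
rewrite /potential => H.
have [|T [mT T0 HT]] := I1.
  by rewrite -[RHS]H; apply: eq_integral => t; rewrite inE => t0; rewrite gee0_abs// Q0.
exists T; split=> // t t0; apply: contra_notP => nQ; apply: HT => /= /(_ t0).
by rewrite (eigen_transition_eq0 _ _ mpi).
Qed.

(** This is the form in which recurrence is applied: a potential that is not infinite at one point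
    rules out the infinite alternative, and zero potential is read back under [P] from every
    starting point. *)
Lemma recurrent_null (pi : borel E -> R) (lambda : R) x (B : set (borel E)) :
  measurable_fun setT pi -> (forall y, 0 < pi y) -> measurable B ->
  recurrent (eigen_transition P X S pi lambda) ->
  potential (eigen_transition P X S pi lambda) x B != +oo%E ->
  forall y, exists T : set R, [/\ measurable T, lebesgue_measure T = 0%E &
    forall t, 0 <= t -> ~ T t -> P y (X t @^-1` B) = 0%E].
Proof.
move=> mpi pi0 mB rec xB y; apply: (@potential_eq0_ae pi lambda) => //.
have [|//|H] := rec B; last by move: xB; rewrite H eqxx.
by move=> mu; exists B, B; split=> //; rewrite setDv measure0.
Qed.

End pricing_operator.

(** * Two eigenfunctions *)

Lemma exists_gt0_off_negligible {R : realType} (T : (set R)^nat) :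
  (forall n, lebesgue_measure.-negligible (T n)) ->
  exists2 t : R, 0 < t & forall n, ~ T n t.
Proof.
move=> T0; have [N [mN N0 TN]] := negligible_bigcup T0.
apply: contrapT => /forall2NP H.
have : lebesgue_measure (`]0, 1[%classic : set R) = 0%E.
  apply: (@subset_measure0 _ _ _ (@lebesgue_measure R) _ N) => // t /=.
  rewrite in_itv/= => /andP[t0 _]; apply: TN; have [//|/existsNP[n /contrapT Tnt]] := H t.
  by exists n.
rewrite lebesgue_measure_itv/= lte_fin ltr01 oppr0 adde0.
by move/eqP; rewrite eqe oner_eq0.
Qed.

Section two_eigenfunctions.
Context {R : realType} {E : ptopologicalType} d {Omega : measurableType d}.
Variables (P : E -> probability Omega R) (X : R -> Omega -> E).
Variables (theta : R -> Omega -> Omega) (S : R -> Omega -> R).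
Hypothesis E_lusin : lusin_space R E.
Hypothesis X_right : borel_right_process P X theta.
Hypothesis S_kernel : pricing_kernel P X theta S.
Variables (p1 p2 : borel E -> R) (l1 l2 : R).
Hypothesis mp1 : measurable_fun setT p1.
Hypothesis mp2 : measurable_fun setT p2.
Hypothesis p1_gt0 : forall y, 0 < p1 y.
Hypothesis p2_gt0 : forall y, 0 < p2 y.
Hypothesis eig1 : eigenfunction P X S p1 l1.
Hypothesis eig2 : eigenfunction P X S p2 l2.
Hypothesis l12 : l1 <= l2.

Local Notation A := (pricing_operator P X S).

Let k (y : borel E) : R := p1 y * p2 y / (p1 y + p2 y).

Let mk : measurable_fun setT k.
Proof.
apply: measurable_funM; first exact: measurable_funM.
apply: measurable_fun_invr_gt0; first exact: measurable_funD.
by move=> y; rewrite addr_gt0.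
Qed.

Let k_gt0 y : 0 < k y.
Proof. by rewrite divr_gt0 ?mulr_gt0 ?addr_gt0. Qed.

Let k_ge0 y : 0 <= k y.
Proof. exact: ltW. Qed.

(** The tangent inequality at [(p1 x, p2 x)] is integrated: the tangent plane is a combination of
    the two eigenfunctions, on which the operator is explicit, and its gap above [k] is the
    nonnegative function [dl]. *)
Lemma harmonic_mean_supereigen (s : R) x : 0 < s ->
  (A s k x <= (expR (- l1 * s) * k x)%:E)%E /\
  (A s k x = (expR (- l1 * s) * k x)%:E ->
   l1 = l2 /\ P x (X s @^-1` [set y | p2 x * p1 y - p1 x * p2 y != 0]) = 0%E).
Proof.
move=> s0; have s0' := ltW s0.
set a := p1 x; set b := p2 x.
have a0 : 0 < a by exact: p1_gt0.
have b0 : 0 < b by exact: p2_gt0.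
have ab0 : 0 < a + b by exact: addr_gt0.
(* The partial derivatives of [u * v / (u + v)] at [(a, b)]. *)
pose al := (b / (a + b)) ^+ 2; pose be := (a / (a + b)) ^+ 2.
have be0 : 0 < be by rewrite exprn_gt0// divr_gt0.
have al0 : 0 < al by rewrite exprn_gt0// divr_gt0.
pose dl (y : borel E) : R :=
  (b * p1 y - a * p2 y) ^+ 2 * ((a + b) ^+ 2 * (p1 y + p2 y))^-1.
have den0 y : 0 < (a + b) ^+ 2 * (p1 y + p2 y).
  by rewrite mulr_gt0 ?exprn_gt0 ?addr_gt0.
have mdl : measurable_fun setT dl.
  apply: measurable_funM.
    by apply: measurable_funX; apply: measurable_funB; exact: measurable_funM.
  apply: measurable_fun_invr_gt0 => //.
  by apply: measurable_funM => //; exact: measurable_funD.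
have dl0 y : 0 <= dl y by rewrite mulr_ge0 ?sqr_ge0// invr_ge0 ltW.
have dec : (fun y => al * p1 y + be * p2 y) = (fun y => 1 * k y + 1 * dl y).
  apply/funext => y; rewrite !mul1r /dl -(harmonic_tangentE a0 b0 (p1_gt0 y) (p2_gt0 y)).
  by rewrite /k [RHS]addrC subrK.
(* Euler's identity for a 1-homogeneous function. *)
have kx : k x = al * a + be * b.
  rewrite /k /al /be -/a -/b; field; exact: lt0r_neq0.
have sum : A s k x + A s dl x =
    (al * (expR (- l1 * s) * a) + be * (expR (- l2 * s) * b))%:E.
  have := @pricing_operator_comb _ _ _ _ _ _ _ _ X_right S_kernel s al be p1 p2 x s0' mp1 mp2.
  rewrite dec (pricing_operator_comb X_right S_kernel)// !mul1e => ->;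
    [|by move=> y; exact: ltW|by move=> y; exact: ltW|exact: ltW|exact: ltW].
  by rewrite eig1// eig2// -!EFinM -EFinD.
have e12 : expR (- l2 * s) <= expR (- l1 * s).
  by rewrite ler_expR !mulNr lerN2 ler_pM2r.
have dl_ge0 : (0 <= A s dl x)%E by exact: pricing_operator_ge0 S_kernel _ _ _ s0' dl0.
have bound : al * (expR (- l1 * s) * a) + be * (expR (- l2 * s) * b) <=
    expR (- l1 * s) * k x.
  rewrite kx mulrDr lerD//; first by rewrite mulrCA.
  by rewrite mulrCA ler_pM2r// (mulr_gt0 be0 b0).
split; first by rewrite (le_trans (leeDl _ dl_ge0))// sum lee_fin.
move=> Ak; move: sum dl_ge0; rewrite Ak.
case Adl : (A s dl x) => [r| |] // [sum]; rewrite lee_fin => r0.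
(* Equality leaves no room for the gap nor for the loss between the two exponentials: the first
   yields the null set, the second [l1 = l2]. *)
have r_eq0 : r = 0.
  apply/eqP; rewrite eq_le r0 andbT -(lerD2l (expR (- l1 * s) * k x)) addr0.
  by rewrite sum.
split.
  move: sum; rewrite r_eq0 addr0 kx mulrDr mulrCA => /addrI.
  rewrite mulrCA => /(mulfI (lt0r_neq0 be0)) /(mulIf (lt0r_neq0 b0)) /expR_inj.
  by move=> /(mulIf (lt0r_neq0 s0)) /oppr_inj.
have [H _] := pricing_operator_eq0 X_right S_kernel x s0' mdl dl0.
rewrite r_eq0 in Adl; have := H Adl.
have -> : [set y | dl y != 0] = [set y | b * p1 y - a * p2 y != 0]; last by [].
by apply/seteqP; split=> y /=;
  rewrite /dl mulf_eq0 invr_eq0 (gt_eqF (den0 y)) orbF expf_eq0.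
Qed.

Lemma harmonic_mean_version (mu : probability (borel E) R) (s : R) : 0 < s ->
  exists (g : borel E -> R) (D : set (borel E)),
    [/\ measurable_fun setT g, forall y, 0 <= g y <= k y,
        measurable D /\ mu D = 0%E,
        forall y, ~ D y -> A s k y = (expR (- l1 * s) * g y)%:E &
        forall x t, 0 <= t -> P x (X t @^-1` D) = 0%E ->
          A (t + s) k x = ((expR (- l1 * s))%:E * A t g x)%E].
Proof.
move=> s0; have s0' := ltW s0.
have [F [D [mF F0 [mD muD] FA AF]]] :=
  pricing_semigroup_version X_right S_kernel mu s0' mk k_ge0.
have Fle y : ~ D y -> (F y <= (expR (- l1 * s) * k y)%:E)%E.
  by move=> Dy; rewrite -FA//; have [] := harmonic_mean_supereigen y s0.
have Ffin y : ~ D y -> F y \is a fin_num.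
  by move=> Dy; rewrite ge0_fin_numE// (le_lt_trans (Fle y Dy))// ltry.
(* Off [D] this is the Borel version of V at time [s]. On [D], where [F] is not controlled, the
   value 0 keeps [g] between 0 and [k] everywhere. *)
pose g (y : borel E) := expR (l1 * s) * ((fine \o F) \_ (~` D)) y.
have gE y : ~ D y -> F y = (expR (- l1 * s) * g y)%:E.
  move=> Dy; rewrite /g patchE mem_set// mulrA -expRD mulNr addNr expR0 mul1r /=.
  by rewrite fineK// Ffin.
have mg : measurable_fun setT g.
  apply: measurable_funM => //.
  apply/(@measurable_restrict _ _ (borel E) _ (~` D) setT) => //; first exact: measurableC.
  apply: measurable_funTS.
  exact: measurableT_comp (@fine_measurable _ setT measurableT) mF.
have g0 y : 0 <= g y.
  by rewrite mulr_ge0 ?expR_ge0// patchE; case: ifP => // _; exact: fine_ge0.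
exists g, D; split=> //.
- move=> y; rewrite g0/=; have [Dy|Dy] := pselect (D y).
    have nDy : (y \in ~` D) = false by apply: memNset => /(_ Dy).
    by rewrite /g patchE nDy mulr0; exact: k_ge0.
  by have := Fle y Dy; rewrite gE// lee_fin ler_pM2l ?expR_gt0.
- by move=> y Dy; rewrite FA// gE.
- move=> x t t0 XD; rewrite AF// [in RHS]pricing_operatorE.
  have S0 w : 0 <= S t w by rewrite ltW// (pk_gt0 S_kernel).
  have mX := measurable_process X_right t0.
  have mSg : measurable_fun setT (fun w => (S t w * g (X t w))%:E).
    by apply/measurable_EFinP; exact (measurable_pricing_kernelM X_right S_kernel t0 mg).
  rewrite -ge0_integralZl_EFin ?expR_ge0//; last first.
    by move=> w _; rewrite lee_fin mulr_ge0.
  apply: (@ge0_integral_eq_off_null _ _ _ (P x) (X t @^-1` D)) => //.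
  + by rewrite -[X in measurable X]setTI; exact: mX.
  + apply: emeasurable_funM; first by apply/measurable_EFinP;
      exact (measurable_pricing_kernel X_right S_kernel t0).
    exact: measurableT_comp mF mX.
  + exact: measurable_funeM.
  + by move=> w; rewrite mule_ge0// lee_fin.
  + by move=> w; rewrite -EFinM lee_fin mulr_ge0 ?expR_ge0// mulr_ge0.
  + by move=> w XDw; rewrite gE// -!EFinM; congr EFin; ring.
Qed.

Let V (t : R) x : R := expR (l1 * t) * fine (A t k x).

Let VE (t : R) x : 0 < t -> A t k x = (expR (- l1 * t) * V t x)%:E.
Proof.
move=> t0; rewrite /V mulrA -expRD mulNr addNr expR0 mul1r fineK//.
rewrite ge0_fin_numE; last exact: pricing_operator_ge0 S_kernel _ _ _ (ltW t0) k_ge0.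
by have [/le_lt_trans -> //] := harmonic_mean_supereigen x t0; rewrite ltry.
Qed.

Let V_ge0 (t : R) x : 0 < t -> 0 <= V t x.
Proof.
move=> t0; rewrite mulr_ge0 ?expR_ge0// fine_ge0//.
exact: pricing_operator_ge0 S_kernel _ _ _ (ltW t0) k_ge0.
Qed.

Let V_le (t : R) x : 0 < t -> V t x <= k x.
Proof.
move=> t0; have [+ _] := harmonic_mean_supereigen x t0.
by rewrite VE// lee_fin ler_pM2l ?expR_gt0.
Qed.

Let V_mono (t s : R) x : 0 < t -> t <= s -> V s x <= V t x.
Proof.
move=> t0; rewrite le_eqVlt => /predU1P[->//|ts].
have st0 : 0 < s - t by rewrite subr_gt0.
have mX := measurable_process X_right (ltW t0).
pose Xm : {mfun _ >-> borel E} := HB.pack (X t : Omega -> borel E)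
  (isMeasurableFun.Build _ _ _ _ _ mX).
(* Taking the version for the law of [X t] under [P x] makes the semigroup identity available at
   exactly this pair [(x, t)]; then [g <= k] gives the monotonicity. *)
have [g [D [mg gk [mD muD] _ AD]]] := harmonic_mean_version (distribution (P x) Xm) st0.
have := AD x t (ltW t0) muD; rewrite subrKC.
have s0 : 0 < s := lt_trans t0 ts.
have := pricing_operator_le X_right S_kernel x (ltW t0) mg mk
  (fun y => proj1 (andP (gk y))) (fun y => proj2 (andP (gk y))).
rewrite VE// => gle Ag.
have : (A s k x <= (expR (- l1 * (s - t)))%:E * (expR (- l1 * t) * V t x)%:E)%E.
  by rewrite Ag lee_wpmul2l// lee_fin expR_ge0.
rewrite VE// -EFinM lee_fin.
have -> : expR (- l1 * (s - t)) * (expR (- l1 * t) * V t x) = expR (- l1 * s) * V t x.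
  by rewrite mulrA -expRD; congr (expR _ * _); ring.
by rewrite ler_pM2l ?expR_gt0.
Qed.

Let measurable_defect_set (j : nat) (g : borel E -> R) : measurable_fun setT g ->
  @measurable _ (borel E) [set y | g y + p1 y / j.+1%:R <= k y].
Proof.
move=> mg.
have mh : measurable_fun setT (fun y => k y - (g y + p1 y / j.+1%:R)).
  apply: measurable_funB => //; apply: measurable_funD => //.
  exact: measurable_funM.
have -> : [set y | g y + p1 y / j.+1%:R <= k y] =
    (fun y => k y - (g y + p1 y / j.+1%:R)) @^-1` `[0, +oo[.
  by apply/seteqP; split=> y; rewrite /= in_itv/= andbT subr_ge0.
by rewrite -[X in measurable X]setTI; exact: mh.
Qed.

(** On the defect set [p1] is at most [j.+1 * (k - g)]. Applying the operator bounds the probability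
    of this set at time [t] by a multiple of [V t x - V (t + n.+1) x], for almost every [t], and
    these differences telescope. *)
Lemma potential_defect_finite (x : E) (n j : nat) (g : borel E -> R) (D : set (borel E))
    (T : set R) :
  measurable_fun setT g -> (forall y, 0 <= g y <= k y) -> 
  (forall t, 0 <= t -> P x (X t @^-1` D) = 0%E ->
     A (t + n.+1%:R) k x = ((expR (- l1 * n.+1%:R))%:E * A t g x)%E) ->
  measurable T -> lebesgue_measure T = 0%E ->
  (forall t, 0 <= t -> ~ T t -> P x (X t @^-1` D) = 0%E) ->
  potential (eigen_transition P X S p1 l1) x
    [set y | g y + p1 y / j.+1%:R <= k y] != +oo%E.
Proof.
move=> mg gk Ag mT T0 TD.
set B := [set y | _].
have mB : measurable B by exact: measurable_defect_set.
(* The bounds on [V] hold at positive times only; at time 0 the dominating value [k x] is used. *)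
pose v (i : nat) := if i is 0%N then k x else V i%:R x.
have v0 i : 0 <= v i by case: i => [|i] //=; exact: V_ge0.
pose C := j.+1%:R / p1 x.
have C0 : 0 <= C by rewrite divr_ge0// ltW.
(* For [t] in [[i, i + 1[] the later time [t + n.+1] stays below [i + n.+2], so monotonicity bounds
   the later value below by [v] at that integer. *)
pose c i := C * (v i - v (i + n.+2)%N).
have vle (t : R) i : 0 < t -> t < i.+1%:R -> v i.+1 <= V t x.
  by move=> t0 ti; apply: V_mono => //; exact: ltW.
have vge (t : R) i : 0 < t -> i%:R <= t -> V t x <= v i.
  by case: i => [|i] t0 it; [exact: V_le|exact: V_mono].
(* Time 0 joins the null set for the same reason. *)
have mT0 : measurable (T `|` [set 0]) by exact: measurableU.
have pot : (potential (eigen_transition P X S p1 l1) x B <=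
    (C * \sum_(i < n.+2) v i)%:E)%E.
  apply: (@integral_le_unit_steps _ _ (T `|` [set 0]) c) => //.
  - exact: (measurable_eigen_transition E_lusin X_right S_kernel).
  - move=> t t0; apply: integral_ge0 => w _; rewrite lee_fin /eigen_martingale.
    by rewrite !mulr_ge0 ?expR_ge0 ?invr_ge0 ?ltW// (pk_gt0 S_kernel).
  - by apply: null_set_setU => //; exact: lebesgue_measure_set1.
  - move=> i t it ti Tt.
    have t0' : 0 <= t by apply: le_trans it.
    have t0 : 0 < t.
      by rewrite lt_neqAle t0' andbT; apply/eqP => t0; apply: Tt; right.
    have Tt' : ~ T t by move=> H; apply: Tt; left.
    have tn0 : 0 < t + n.+1%:R by rewrite addr_gt0.
    have mp1B : measurable_fun setT (fun y : borel E => p1 y * \1_B y).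
      by apply: measurable_funM => //; exact: measurable_indic.
    have p1B0 y : 0 <= p1 y * \1_B y by rewrite mulr_ge0// ltW.
    have g0 y : 0 <= g y by case/andP: (gk y).
    have lek y : j.+1%:R^-1 * (p1 y * \1_B y) + 1 * g y <= k y.
      rewrite indicE mul1r; case: (boolP (y \in B)).
        by rewrite inE /B /= mulr1 addrC [_^-1 * _]mulrC.
      by rewrite !mulr0 add0r; case/andP: (gk y).
    have := @pricing_operator_le _ _ _ _ _ _ _ _ X_right S_kernel t
      (fun y => j.+1%:R^-1 * (p1 y * \1_B y) + 1 * g y) k x t0' _ mk _ lek.
    rewrite (pricing_operator_comb X_right S_kernel)// ?invr_ge0// mul1e.
    have -> : A t g x = (expR (- l1 * t) * V (t + n.+1%:R) x)%:E.
      have := Ag t t0' (TD t t0' Tt'); rewrite VE// => H.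
      have : ((expR (l1 * n.+1%:R))%:E *
          (expR (- l1 * (t + n.+1%:R)) * V (t + n.+1%:R) x)%:E)%E = A t g x.
        rewrite H muleA -EFinM -expRD mulNr subrr expR0 mul1e//.
      move=> <-; rewrite -EFinM mulrA -expRD; congr (expR _ * _)%:E; ring.
    rewrite VE// => H.
    rewrite (eigen_transitionE E_lusin X_right S_kernel)//.
    have {}H : ((j.+1%:R^-1)%:E * A t (fun y => (p1 y * \1_B y)%R) x <=
        (expR (- l1 * t) * (V t x - V (t + n.+1%:R) x))%:E)%E.
      rewrite mulrBr EFinB leeBrDr//; apply: H.
        by apply: measurable_funD; exact: measurable_funM.
      move=> y; rewrite mul1r; apply: addr_ge0; last exact: g0.
      by apply: mulr_ge0 => //; rewrite invr_ge0.
    apply: (@le_trans _ _ ((expR (l1 * t) * C)%:E *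
        ((j.+1%:R^-1)%:E * A t (fun y => (p1 y * \1_B y)%R) x))%E).
      rewrite muleA -EFinM /C.
      rewrite (_ : expR (l1 * t) * (j.+1%:R / p1 x) / j.+1%:R = expR (l1 * t) / p1 x)//.
      by field; rewrite (lt0r_neq0 (p1_gt0 x)) addrC natr1 pnatr_eq0.
    apply: (le_trans (lee_wpmul2l _ H)); first by rewrite lee_fin mulr_ge0 ?expR_ge0.
    rewrite -EFinM lee_fin mulrACA -expRD mulNr subrr expR0 mul1r /c ler_wpM2l//.
    apply: lerB; first exact: vge.
    rewrite addnS; apply: vle => //.
    by rewrite -addSn natrD ltrD2r.
  - move=> i; rewrite /c mulr_ge0// subr_ge0 addnS.
    case: i => [|i]; first by rewrite /= V_le.
    by rewrite /=; apply: V_mono => //; rewrite ler_nat ltnW// ltnS leq_addr.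
  - by move=> m; rewrite -mulr_sumr ler_wpM2l// sum_shift_diff_le.
by apply/negP => /eqP H; move: pot; rewrite H leye_eq.
Qed.

(** The exceptional sets [D n] and [B n j] are countably many, each missed at almost every time from
    the base point. One time and then one path avoid them all, and the position reached is the
    steady point. *)
Lemma exists_steady_point :
  recurrent (eigen_transition P X S p1 l1) ->
  exists x1, forall s, 0 < s -> A s k x1 = (expR (- l1 * s) * k x1)%:E.
Proof.
move=> rec; have [nu nuP] := occupation_law E_lusin X_right point.
have /choice[gDT gDTP] : forall n : nat, exists gDT : (borel E -> R) * set (borel E) * set R,
    [/\ measurable_fun setT gDT.1.1, forall y, 0 <= gDT.1.1 y <= k y,
        forall y, ~ gDT.1.2 y -> A n.+1%:R k y = (expR (- l1 * n.+1%:R) * gDT.1.1 y)%:E,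
        forall x t, 0 <= t -> P x (X t @^-1` gDT.1.2) = 0%E ->
          A (t + n.+1%:R) k x = ((expR (- l1 * n.+1%:R))%:E * A t gDT.1.1 x)%E &
        [/\ measurable gDT.1.2, measurable gDT.2, lebesgue_measure gDT.2 = 0%E &
          forall t, 0 <= t -> ~ gDT.2 t -> P point (X t @^-1` gDT.1.2) = 0%E]].
  move=> n; have n0 : 0 < n.+1%:R :> R by [].
  have [g [D [mg gk [mD muD] AD Ag]]] := harmonic_mean_version nu n0.
  have [T [mT T0 TD]] := nuP D mD muD.
  by exists (g, D, T); split.
pose g n := (gDT n).1.1; pose D n := (gDT n).1.2; pose T n := (gDT n).2.
pose B n j := [set y | g n y + p1 y / j.+1%:R <= k y].
have mB n j : @measurable _ (borel E) (B n j).
  have [mg _ _ _ _] := gDTP n; exact: measurable_defect_set.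
have BT n : forall j, exists T' : set R, [/\ measurable T', lebesgue_measure T' = 0%E &
    forall t, 0 <= t -> ~ T' t -> P point (X t @^-1` B n j) = 0%E].
  move=> j; have [mg gk AD Ag [mD mT T0 TD]] := gDTP n.
  apply: (recurrent_null E_lusin X_right S_kernel mp1 p1_gt0 (mB n j) rec (x := point)).
  exact (potential_defect_finite j mg gk (Ag point) mT T0 TD).
have /choice[T' T'P] : forall n, exists T' : nat -> set R, forall j,
    [/\ measurable (T' j), lebesgue_measure (T' j) = 0%E &
      forall t, 0 <= t -> ~ T' j t -> P point (X t @^-1` B n j) = 0%E].
  by move=> n; have [T' T'P] := choice (BT n); exists T'.
have [t t0 tT] : exists2 t : R, 0 < t & forall n, ~ (T n `|` \bigcup_j T' n j) t.
  apply: exists_gt0_off_negligible => n; apply: negligibleU.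
    have [_ _ _ _ [mD mT T0 TD]] := gDTP n.
    by exists (T n); split.
  apply: negligible_bigcup => j; have [mT' T'0 _] := T'P n j.
  by exists (T' n j); split.
have t0' := ltW t0; have mX := measurable_process X_right t0'.
have negl : (P point).-negligible
    (\bigcup_n (X t @^-1` D n `|` \bigcup_j X t @^-1` B n j)).
  apply: negligible_bigcup => n; apply: negligibleU.
    have [_ _ _ _ [mD mT T0 TD]] := gDTP n.
    exists (X t @^-1` D n); split=> //.
      by rewrite -[X in measurable X]setTI; exact: mX.
    by apply: TD => // Tt; apply: (tT n); left.
  apply: negligible_bigcup => j; have [mT' T'0 T'B] := T'P n j.
  exists (X t @^-1` B n j); split=> //.
    by rewrite -[X in measurable X]setTI; exact: mX.
  by apply: T'B => // T't; apply: (tT n); right; exists j.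
have [w Xw] : exists w, forall n, ~ D n (X t w) /\ forall j, ~ B n j (X t w).
  apply: contrapT => /forallNP nw.
  have [N [mN N0 DBN]] := negl.
  have : P point setT = 0%E.
    apply: (@subset_measure0 _ _ _ (P point) setT N) => // w _; apply: DBN.
    apply: contrapT => H; apply: (nw w) => n; split=> [Dn|j Bnj]; apply: H; exists n => //.
      by left.
    by right; exists j.
  by rewrite probability_setT => /eqP; rewrite eqe oner_eq0.
exists (X t w) => s s0.
have Vk n : V n.+1%:R (X t w) = k (X t w).
  have [mg gk AD _ _] := gDTP n; have [Dw Bw] := Xw n.
  have : g n (X t w) = k (X t w).
    apply/eqP; rewrite eq_le; have /andP[_ ->] := gk (X t w); rewrite /=.
    rewrite leNgt; apply/negP => gk'.
    have e0 : 0 < k (X t w) - g n (X t w) by rewrite subr_gt0.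
    (* [X t w] would lie in [B n j] for any [j.+1 >= p1 / (k - g n)]. *)
    apply: (Bw (Num.truncn (p1 (X t w) / (k (X t w) - g n (X t w))))).
    rewrite /B /= -lerBrDl ler_pdivrMr// mulrC -ler_pdivrMr//.
    by apply: ltW; exact: truncnS_gt.
  by rewrite /V (AD _ Dw) /= mulrA -expRD mulNr subrr expR0 mul1r.
(* Equality with [k] is known at positive integers; monotonicity carries it back from the next
   integer to [s]. *)
have n0 : 0 < (Num.truncn s).+1%:R :> R by [].
have Vs : V s (X t w) = k (X t w).
  apply/eqP; rewrite eq_le V_le//= -(Vk (Num.truncn s)) V_mono//.
  by apply: ltW; exact: truncnS_gt.
by rewrite VE// Vs.
Qed.

Lemma recurrent_proportional :
  recurrent (eigen_transition P X S p1 l1) ->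
  exists2 c : R, 0 < c & forall x, p2 x = c * p1 x.
Proof.
move=> rec; have [x1 steady] := exists_steady_point rec.
(* The points whose ratio differs from that at [x1], in the shape in which the tangent gap detects
   them. *)
pose B : set (borel E) := [set y | p2 x1 * p1 y - p1 x1 * p2 y != 0].
have mB : measurable B.
  have mh : measurable_fun setT (fun y => p2 x1 * p1 y - p1 x1 * p2 y).
    by apply: measurable_funB; exact: measurable_funM.
  have -> : B = ~` ((fun y => p2 x1 * p1 y - p1 x1 * p2 y) @^-1` [set 0]).
    by apply/seteqP; split=> y /= /eqP.
  by apply: measurableC; rewrite -[X in measurable X]setTI; exact: mh.
have steadyB s : 0 < s -> P x1 (X s @^-1` B) = 0%E.
  move=> s0; have [_ H] := harmonic_mean_supereigen x1 s0.
  by have [_ ->] := H (steady s s0).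
have l12E : l1 = l2.
  have [_ H] := harmonic_mean_supereigen x1 ltr01.
  by have [] := H (steady 1 ltr01).
have potB : potential (eigen_transition P X S p1 l1) x1 B != +oo%E.
  have : (potential (eigen_transition P X S p1 l1) x1 B <= 0%:E)%E.
    apply: (@integral_le_unit_steps _ _ [set 0] (fun=> 0)) => //.
    - exact: (measurable_eigen_transition E_lusin X_right S_kernel).
    - move=> t t0; apply: integral_ge0 => w _; rewrite lee_fin /eigen_martingale.
      by rewrite !mulr_ge0 ?expR_ge0 ?invr_ge0 ?ltW// (pk_gt0 S_kernel).
    - exact: lebesgue_measure_set1.
    - move=> i t it _ /eqP t_neq0.
      have t0 : 0 < t by rewrite lt_neqAle eq_sym t_neq0 (le_trans _ it).
      have [_ H] := eigen_transition_eq0 E_lusin X_right S_kernel l1 x1 mp1 p1_gt0 mB (ltW t0).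
      by rewrite H// steadyB.
    - by move=> m; rewrite big1.
  by move=> H; apply/eqP => Hoo; move: H; rewrite Hoo leye_eq.
exists (p2 x1 / p1 x1) => [|y]; first exact: divr_gt0.
have [T [mT T0 TB]] := recurrent_null E_lusin X_right S_kernel mp1 p1_gt0 mB rec potB y.
have [t t0 tT] : exists2 t : R, 0 < t & forall n : nat, ~ T t.
  by apply: exists_gt0_off_negligible => _; exists T; split.
have t0' := ltW t0; have mX := measurable_process X_right t0'.
have S0 w : 0 <= S t w by rewrite ltW// (pk_gt0 S_kernel).
have c0 : 0 <= p2 x1 / p1 x1 by rewrite ltW// divr_gt0.
have mSp2 : measurable_fun setT (fun w => (S t w * p2 (X t w))%:E).
  by apply/measurable_EFinP; exact (measurable_pricing_kernelM X_right S_kernel t0' mp2).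
have mSp1 : measurable_fun setT (fun w => (S t w * p1 (X t w))%:E).
  by apply/measurable_EFinP; exact (measurable_pricing_kernelM X_right S_kernel t0' mp1).
(* One good time suffices: proportionality on almost every [X t] passes through the operator, and
   the eigenvalue equations bring it back to [y] itself. *)
have : A t p2 y = ((p2 x1 / p1 x1)%:E * A t p1 y)%E.
  rewrite !pricing_operatorE -ge0_integralZl_EFin//; last first.
    by move=> w _; rewrite lee_fin mulr_ge0// ltW.
  apply: (@ge0_integral_eq_off_null _ _ _ (P y) (X t @^-1` B)) => //.
  - by rewrite -[X in measurable X]setTI; exact: mX.
  - exact: TB t0' (tT 0%N).
  - exact: measurable_funeM.
  - by move=> w; rewrite lee_fin mulr_ge0// ltW.
  - by move=> w; rewrite -EFinM lee_fin mulr_ge0// mulr_ge0// ltW.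
  move=> w /negP; rewrite negbK subr_eq0 => /eqP e; rewrite -EFinM; congr EFin.
  have p10 := lt0r_neq0 (p1_gt0 x1).
  apply: (mulfI p10); rewrite mulrCA -e.
  by field.
rewrite eig1// eig2// -l12E -EFinM => -[]; rewrite mulrCA.
by apply: mulfI; rewrite gt_eqF ?expR_gt0.
Qed.

End two_eigenfunctions.

Theorem theorem3p1 (R : realType) (E : ptopologicalType)
  (d : measure_display) (Omega : measurableType d)
  (P : E -> probability Omega R) (X : R -> Omega -> E)
  (theta : R -> Omega -> Omega) (S : R -> Omega -> R)
  (E_lusin : lusin_space R E)
  (E_two_points : exists x y : E, x <> y)
  (X_right : borel_right_process P X theta)
  (S_kernel : pricing_kernel P X theta S)
  (pi1 pi2 : E -> R)
  (pi1_rec : recurrent_eigenfunction P X S pi1)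
  (pi2_rec : recurrent_eigenfunction P X S pi2) :
  exists2 c : R, 0 < c & forall x : E, pi2 x = c * pi1 x.
Proof.
have [[m1 pos1] [l1 eig1 rec1]] := pi1_rec.
have [[m2 pos2] [l2 eig2 rec2]] := pi2_rec.
(* The eigenfunction with the smaller exponent takes the role of the reference; in the reversed case
   the constant is inverted. *)
have [l12|/ltW l21] := leP l1 l2.
  exact: (recurrent_proportional E_lusin X_right S_kernel m1 m2 pos1 pos2 eig1 eig2).
have [c c0 pi12] := recurrent_proportional E_lusin X_right S_kernel
  m2 m1 pos2 pos1 eig2 eig1 l21 rec2.
exists c^-1 => [|x]; first by rewrite invr_gt0.
by rewrite pi12 mulKf// gt_eqF.
Qed.
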